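(* Let $\Bbbk$ be a field of positive characteristic, let $n\geq 1$ be an integer, and let $X=(x_{ij})_{1\le i,j\le n}$ and $Y=(y_{ij})_{1\le i,j\le n}$ be $n\times n$ matrices of indeterminates over $\Bbbk$. Let $C=XY-YX=(c_{ij})_{1\le i,j\le n}$ be their commutator matrix. In the polynomial ring $\Bbbk[X,Y]$ in the $2n^2$ indeterminates $x_{ij},y_{ij}$, let $\mathfrak{a}$ be the ideal generated by the anti-diagonal entries of $C$, and let $\mathfrak{c}$ be the ideal generated by the cross-diagonal entries of $C$, that is, by the diagonal entries together with the anti-diagonal entries of $C$. Then $\Bbbk[X,Y]/\mathfrak{c}$ is $F$-regular for each $n$, while $\Bbbk[X,Y]/\mathfrak{a}$ is $F$-regular exactly when $n\neq 2$.
   Context: The diagonal entries of $C$ are $c_{ii}$ and the anti-diagonal entries are $c_{i,n+1-i}$, for $1\le i\le n$. Let $R$ be a Noetherian commutative ring of prime characteristic $p>0$, and let $R^\circ$ denote the complement of the union of the minimal primes of $R$. The ring $R$ is strongly $F$-regular if for each $c\in R^\circ$ there exists $q=p^e$ such that the $R$-linear map $R\to R^{1/q}$, $1\mapsto c^{1/q}$, splits. There are also the notions of weak $F$-regularity (every ideal is tightly closed) and $F$-regularity (every localization is weakly $F$-regular). For $\mathbb{N}$-graded rings (such as those considered here, graded by total degree) these three notions coincide, and ''$F$-regular'' refers to any of them. *)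

(* Defs.v *)
From HB Require Import structures.
From mathcomp Require Import all_boot all_order all_algebra.
From mathcomp Require Import ring_quotient boolp.
From mathcomp.multinomials Require Import mpoly.

Set Implicit Arguments.
Unset Strict Implicit.
Unset Printing Implicit Defensive.

Import GRing.Theory.
Local Open Scope ring_scope.

Section Ideals.
Variable R : comNzRingType.
Implicit Types (A I P Q : R -> Prop).

Definition ideal I : Prop :=
  [/\ I 0, forall x y, I x -> I y -> I (x + y) & forall a x, I x -> I (a * x)].

Definition ideal_gen A : R -> Prop := fun x =>
  exists s : seq (R * R),
    (forall t, t \in s -> A t.2) /\ x = \sum_(t <- s) t.1 * t.2.

Definition prime_ideal P : Prop :=
  [/\ ideal P, ~ P 1 & forall x y, P (x * y) -> P x \/ P y].

Definition minimal_prime P : Prop :=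
  prime_ideal P /\
  forall Q, prime_ideal Q -> (forall x, Q x -> P x) -> forall x, P x -> Q x.

(* The set R° *)
Definition off_minimal_primes : R -> Prop := fun c =>
  forall P, minimal_prime P -> ~ P c.

Definition multiplicative_set (S : R -> Prop) : Prop :=
  S 1 /\ forall x y, S x -> S y -> S (x * y).

(* The library has no localization of a general commutative ring: this says
   that f exhibits L as a model of S^-1 R. As L is nontrivial this leaves out
   only the zero ring, all of whose ideals are trivially tightly closed. *)
Definition is_localization (S : R -> Prop) (L : comNzRingType)
    (f : {rmorphism R -> L}) : Prop :=
  [/\ forall s, S s -> exists t, f s * t = 1,
      forall z, exists r s, S s /\ z * f s = f r
    & forall r, f r = 0 -> exists2 s, S s & s * r = 0].

End Ideals.

(* R^{1/q} for q = p ^ e: its elements are the q-th roots of the elements of R,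
   so that additively it is a copy of R, on which a in R acts by
   a *: v^{1/q} = (a ^ q * v)^{1/q}. *)
Definition frobenius_root (R : comNzRingType) (p e : nat)
  (charRp : p \in [pchar R]) : Type := R.

Section FrobeniusRoot.
Variables (R : comNzRingType) (p e : nat) (charRp : p \in [pchar R]).
Local Notation M := (frobenius_root e charRp).

HB.instance Definition _ := GRing.Zmodule.on M.

Definition qroot (v : R) : M := v.

Definition frobenius_root_scale (a : R) (v : M) : M :=
  qroot (a ^+ (p ^ e) * (v : R)).

Lemma pchar_exprDpe (x y : R) :
  (x + y) ^+ (p ^ e) = x ^+ (p ^ e) + y ^+ (p ^ e).
Proof.
by apply: exprDn_pchar; rewrite pnatX pnatE ?charRp // (pcharf_prime charRp).
Qed.

Fact frobenius_root_scaleA a b v :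
  frobenius_root_scale a (frobenius_root_scale b v)
  = frobenius_root_scale (a * b) v.
Proof. by rewrite /frobenius_root_scale /qroot exprMn mulrA. Qed.

Fact frobenius_root_scale1 : left_id 1 frobenius_root_scale.
Proof. by move=> v; rewrite /frobenius_root_scale /qroot expr1n mul1r. Qed.

Fact frobenius_root_scaleDr : right_distributive frobenius_root_scale +%R.
Proof. by move=> a u v; rewrite /frobenius_root_scale /qroot mulrDr. Qed.

Fact frobenius_root_scaleDl v :
  {morph frobenius_root_scale^~ v : a b / a + b}.
Proof.
by move=> a b; rewrite /frobenius_root_scale /qroot pchar_exprDpe mulrDl.
Qed.

HB.instance Definition _ := GRing.Zmodule_isLmodule.Build R M
  frobenius_root_scaleA frobenius_root_scale1
  frobenius_root_scaleDr frobenius_root_scaleDl.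

End FrobeniusRoot.

(* The R-linear map R -> R^{1/q} sending 1 to c^{1/q} is r |-> r *: c^{1/q}.
   For reduced R, allowing e = 0 makes no difference; but frobenius_root makes
   sense for every R, and e = 0 would let in k[x]/(x^2), whose R° consists of
   units. *)
Definition strongly_F_regular (R : comNzRingType) : Prop :=
  exists (p : nat) (charRp : p \in [pchar R]),
    forall c : R, off_minimal_primes c ->
      exists2 e, (0 < e)%N &
        exists phi : {linear frobenius_root e charRp -> R^o},
          forall r : R, phi (r *: qroot e charRp c) = r.

(* The Frobenius power I^[q] *)
Definition frobenius_power (R : comNzRingType) (I : R -> Prop) (q : nat) :
    R -> Prop :=
  ideal_gen (fun x => exists2 y, I y & x = y ^+ q).

Definition tight_closure (R : comNzRingType) (p : nat) (I : R -> Prop) :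
    R -> Prop := fun u =>
  exists2 c, off_minimal_primes c &
    exists e0 : nat, forall e, (e0 <= e)%N ->
      frobenius_power I (p ^ e) (c * u ^+ (p ^ e)).

Definition weakly_F_regular (R : comNzRingType) : Prop :=
  exists2 p, p \in [pchar R] &
    forall I : R -> Prop, ideal I -> forall u, tight_closure p I u -> I u.

Definition locally_weakly_F_regular (R : comNzRingType) : Prop :=
  forall (S : R -> Prop) (L : comNzRingType) (f : {rmorphism R -> L}),
    multiplicative_set S -> is_localization S f -> weakly_F_regular L.

(* The three notions, which coincide for N-graded rings; a statement about
   "F-regular" graded rings is made for each of them. *)
Inductive F_regularity := StronglyFRegular | FRegular | WeaklyFRegular.

Definition F_regular (v : F_regularity) (R : comNzRingType) : Prop :=
  match v with
  | StronglyFRegular => strongly_F_regular R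
  | FRegular => locally_weakly_F_regular R
  | WeaklyFRegular => weakly_F_regular R
  end.

Section Commutator.
Variables (k : fieldType) (n : nat).

Notation kXY := {mpoly k[n * n + n * n]}.

(* mxvec_index i j enumerates the pairs (i, j); the first n * n variables are
   the x_ij and the last n * n are the y_ij. *)
Definition matX : 'M[kXY]_n :=
  \matrix_(i, j) 'X_(lshift (n * n) (mxvec_index i j)).
Definition matY : 'M[kXY]_n :=
  \matrix_(i, j) 'X_(rshift (n * n) (mxvec_index i j)).

Definition matC : 'M[kXY]_n := matX *m matY - matY *m matX.

Definition diag_entry (f : kXY) : Prop := exists i, f = matC i i.
(* rev_ord is i |-> n + 1 - i on indices numbered from 1 *)
Definition antidiag_entry (f : kXY) : Prop := exists i, f = matC i (rev_ord i).
Definition crossdiag_entry (f : kXY) : Prop :=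
  diag_entry f \/ antidiag_entry f.

(* Ring quotients in the library are by proper ideals given as boolean
   predicates; a and c are proper as they vanish at X = Y = 0. *)
Definition in_ideal_a : pred kXY := fun f => `[< ideal_gen antidiag_entry f >].
Definition in_ideal_c : pred kXY := fun f => `[< ideal_gen crossdiag_entry f >].

Lemma matC_eval0 i j : (matC i j).@[fun=> 0] = 0.
Proof.
have E0 (A B : 'M[kXY]_n) :
    (forall l m, (A l m).@[fun=> 0] = 0) -> ((A *m B) i j).@[fun=> 0] = 0.
  move=> A0; rewrite mxE raddf_sum big1 // => l _.
  by rewrite /= mevalM A0 mul0r.
rewrite /matC mxE [X in _ + X]mxE mevalB !E0 ?subr0 // => l m;
  by rewrite mxE mevalXU.
Qed.

Lemma ideal_gen_idealr (A : kXY -> Prop) :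
  (forall f, A f -> f.@[fun=> 0] = 0) ->
  idealr_closed (fun f => `[< ideal_gen A f >]).
Proof.
move=> A0; split.
- by apply/asboolP; exists [::]; rewrite big_nil.
- apply/asboolP => -[s [sA s1]].
  have /eqP := congr1 (meval (fun=> 0)) s1.
  rewrite meval1 raddf_sum big_seq big1 ?oner_eq0 // => t ts.
  by rewrite /= mevalM [X in _ * X]A0 ?mulr0 //; exact: sA.
move=> a u v /asboolP [s [sA ->]] /asboolP [t [tA ->]]; apply/asboolP.
exists ([seq (a * x.1, x.2) | x <- s] ++ t); split=> [x|].
  rewrite mem_cat => /orP[/mapP[y ys ->]|/tA //]; exact: sA ys.
rewrite big_cat big_map mulr_sumr; congr (_ + _).
by apply: eq_bigr => x _; rewrite mulrA.
Qed.

Fact ideal_a_closed : idealr_closed in_ideal_a.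
Proof. by apply: ideal_gen_idealr => f [i ->]; apply: matC_eval0. Qed.

Fact ideal_c_closed : idealr_closed in_ideal_c.
Proof.
by apply: ideal_gen_idealr => f [] [i ->]; apply: matC_eval0.
Qed.

HB.instance Definition _ := isIdealr.Build kXY in_ideal_a ideal_a_closed.
HB.instance Definition _ := isIdealr.Build kXY in_ideal_c ideal_c_closed.

Definition ideal_a : idealr kXY := in_ideal_a.
Definition ideal_c : idealr kXY := in_ideal_c.

End Commutator.

Arguments ideal_a : clear implicits.
Arguments ideal_c : clear implicits.

(* Main.v *)
(* Let S be a polynomial ring over k, let I be a proper ideal and let q range
   over the powers of p. If F I is contained in I^[q], then v |-> T(F v), for T
   the trace S^{1/q} -> S, descends to S/I, so that it suffices to find enough
   such F.

   Suppose that I contains elements g = d z + r, one for each of some variables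
   z to be eliminated, with d and r free of z and of the variables that are
   eliminated later, and d free of all of them; let D be the product of the d's.
   A multiple of every element of S by a power of D is, modulo I, a polynomial b
   in the other variables, and if b is nonzero, then taking F to be a multiple
   of the product of the g^(q-1) gives a map sending b to D. If another choice of
   F gives a map sending D to 1, then D is a nonzerodivisor modulo I, I is prime
   and S/I is strongly F-regular, hence F-regular. That F exists as soon as, for
   some weights on the variables, F D has a leading monomial with all exponents
   less than q.

   For n >= 3 the product of the q-1st powers of the generators serves as F: there
   are weights for which the generators have squarefree and pairwise coprime
   leading monomials, which moreover are coprime to that of D, where the
   entries c_ii with 1 < i < n are solved for x_in, and each pair c_{i,n+1-i}, c_{n+1-i,i} for
   the diagonal variables x_ii and y_ii. For n = 2 the ideal c is generated by
   the maximal minors of a 2 x 3 matrix, one column of which is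
   (a, b) = (x_11 - x_22, y_11 - y_22), and is no complete intersection; an F is
   found by hand. The ideal of the anti-diagonal entries, two of those minors,
   is not prime: if d is the third, then a d = b d = 0, and a lies in the tight
   closure of (a + d), because (a + d) a^q = a (a + d)^q, but not in (a + d). *)
Require Import Defs.
From HB Require Import structures.
From mathcomp Require Import all_boot all_order all_algebra.
From mathcomp Require Import ring_quotient boolp.
From mathcomp.multinomials Require Import mpoly.
From mathcomp Require classical_sets.
From mathcomp Require Import ring zify.

Set Implicit Arguments.
Unset Strict Implicit.
Unset Printing Implicit Defensive.

Import GRing.Theory.
Local Open Scope ring_scope.

(** * Semilinear splittings and F-regularity *)

Section SemilinearMaps.
Variable R : comNzRingType.
Implicit Types (f : R -> R) (I : R -> Prop).

(** An [R]-linear map from R^(1/q) to R, read as an additive map of R to itself by writing x for its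
    q-th root. *)
Definition root_linear (q : nat) f : Prop :=
  (forall x y, f (x + y) = f x + f y) /\ (forall a x, f (a ^+ q * x) = a * f x).

Definition splits_at (q : nat) (c : R) : Prop :=
  exists2 f, root_linear q f & f c = 1.

Lemma root_linear_mul q f c : root_linear q f -> root_linear q (fun x => f (c * x)).
Proof.
move=> [fD fZ]; split=> [x y|a x]; first by rewrite mulrDr fD.
by rewrite mulrCA fZ.
Qed.

Lemma root_linear_comp q1 q2 f1 f2 :
  root_linear q1 f1 -> root_linear q2 f2 ->
  root_linear (q1 * q2) (fun x => f1 (f2 x)).
Proof.
move=> [f1D f1Z] [f2D f2Z]; split=> [x y|a x]; first by rewrite f2D f1D.
by rewrite exprM f2Z f1Z.
Qed.

Lemma root_linear0 q f : root_linear q f -> f 0 = 0.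
Proof. by case=> fD _; apply: (addIr (f 0)); rewrite -fD !add0r. Qed.

Lemma root_linear_sum q f (T : eqType) (s : seq T) (F : T -> R) :
  root_linear q f -> f (\sum_(t <- s) F t) = \sum_(t <- s) f (F t).
Proof. by move=> fq; apply: (big_morph f fq.1 (root_linear0 fq)). Qed.

Lemma ideal_sum I (T : eqType) (s : seq T) (F : T -> R) :
  ideal I -> (forall t, t \in s -> I (F t)) -> I (\sum_(t <- s) F t).
Proof. by case=> I0 ID _ IF; rewrite big_seq; elim/big_ind: _. Qed.

(** By semilinearity [f] sends a y^q to y f(a). *)
Lemma root_linear_frobenius_power q f I x :
  ideal I -> root_linear q f -> frobenius_power I q x -> I (f x).
Proof.
move=> idI fq [s [sI ->]]; rewrite (root_linear_sum _ _ fq).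
apply: ideal_sum => // t ts; have [y Iy ->] := sI t ts.
by rewrite mulrC fq.2 mulrC; case: idI => _ _; apply.
Qed.

Lemma splits_atMr q c d : splits_at q (c * d) -> splits_at q c.
Proof.
case=> f fq fcd; exists (fun x => f (d * x)); first exact: root_linear_mul.
by rewrite mulrC.
Qed.

Lemma splits_at1 q c : splits_at q c -> splits_at q 1.
Proof. by rewrite -[c]mul1r; apply: splits_atMr. Qed.

(** As q2 > 0, c divides c^q2, which the second map sends to c and the first map then to 1. *)
Lemma splits_at_comp q1 q2 c :
  (0 < q2)%N -> splits_at q1 c -> splits_at q2 1 -> splits_at (q1 * q2) c.
Proof.
move=> q2_gt0 [f fq fc] [g gq g1]; apply: (@splits_atMr _ _ (c ^+ q2.-1)).
rewrite -exprS prednK //; exists (fun x => f (g x)).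
  exact: root_linear_comp.
by rewrite -[X in g X]mulr1 gq.2 g1 mulr1.
Qed.

(** Tight closure constrains only large exponents, so splittings are needed beyond any bound; they
    come from composing one with itself. *)
Lemma splits_at_large p e c e0 :
  (0 < p)%N -> (0 < e)%N -> splits_at (p ^ e) c ->
  exists2 e', (e0 <= e')%N & splits_at (p ^ e') c.
Proof.
move=> p0 e_gt0 ce; exists (e * e0.+1)%N.
  by rewrite (leq_trans (leqnSn _)) // leq_pmull.
elim: e0 => [|e0 IH]; first by rewrite muln1.
rewrite mulnS expnD; apply: splits_at_comp => //; first by rewrite expn_gt0 p0.
exact: splits_at1 IH.
Qed.

(** A map with f(c) = 1 sends c u^q to u and I^[q] into I. *)
Lemma splits_at_frobenius_power q c I u :
  ideal I -> splits_at q c -> frobenius_power I q (c * u ^+ q) -> I u.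
Proof.
move=> idI [f fq fc] /(root_linear_frobenius_power idI fq).
by rewrite mulrC fq.2 fc mulr1.
Qed.

Lemma ideal_gen_ideal (A : R -> Prop) : ideal (ideal_gen A).
Proof.
split; first by exists [::]; rewrite big_nil.
- move=> x y [s [sA ->]] [t [tA ->]]; exists (s ++ t); rewrite big_cat.
  by split=> // z; rewrite mem_cat => /orP[/sA|/tA].
move=> a x [s [sA ->]]; exists [seq (a * t.1, t.2) | t <- s]; split.
  by move=> z /mapP[t ts ->]; apply: sA ts.
by rewrite big_map mulr_sumr; apply: eq_bigr => t _; rewrite mulrA.
Qed.

Lemma mem_ideal_gen (A : R -> Prop) x : A x -> ideal_gen A x.
Proof.
move=> Ax; exists [:: (1, x)]; rewrite big_seq1 mul1r; split=> // t.
by rewrite inE => /eqP ->.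
Qed.

Lemma ideal_gen_min (A I : R -> Prop) x :
  ideal I -> (forall y, A y -> I y) -> ideal_gen A x -> I x.
Proof.
move=> idI AI [s [sA ->]]; apply: ideal_sum => // t ts.
by case: idI => _ _; apply; apply/AI/sA.
Qed.

Lemma idealN I x : ideal I -> I x -> I (- x).
Proof. by case=> _ _ IM Ix; rewrite -mulN1r; apply: IM. Qed.

Lemma idealB I x y : ideal I -> I x -> I y -> I (x - y).
Proof. by move=> idI Ix Iy; case: (idI) => _ + _; apply=> //; apply: idealN. Qed.

Lemma ideal_mulr I x a : ideal I -> I x -> I (x * a).
Proof. by case=> _ _ IM Ix; rewrite mulrC; apply: IM. Qed.

(** In a domain the zero ideal is a minimal prime. *)
Lemma off_minimal_primes_neq0 (c : R) :
  (forall x y : R, x * y = 0 -> x = 0 \/ y = 0) ->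
  off_minimal_primes c -> c <> 0.
Proof.
move=> domR /(_ (fun x => x = 0)) off c0; apply: off c0; split.
  split; last exact: domR.
    by split=> // [x y -> ->|a x ->]; rewrite ?addr0 ?mulr0.
  by apply/eqP; rewrite oner_eq0.
by move=> Q [[Q0 _ _] _ _] _ x ->.
Qed.

End SemilinearMaps.

(** * Domains that split at every nonzero element are F-regular in all three senses *)

Section FrobeniusSplitting.
Variables (R : comNzRingType) (p : nat).
Hypothesis charRp : p \in [pchar R].
Hypothesis domR : forall x y : R, x * y = 0 -> x = 0 \/ y = 0.
Hypothesis splitR :
  forall c : R, c <> 0 -> exists2 e, (0 < e)%N & splits_at (p ^ e) c.

Let p_gt0 : (0 < p)%N.
Proof. exact: prime_gt0 (pcharf_prime charRp). Qed.

Lemma strongly_F_regular_split : strongly_F_regular R.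
Proof.
exists p, charRp => c /(off_minimal_primes_neq0 domR) /splitR[e e_gt0].
case=> f [fD fZ] fc; exists e => //.
pose f0 : frobenius_root e charRp -> R^o := f.
have f0_lin : linear f0.
  by move=> a x y; rewrite /f0 fD; congr (_ + _); exact: fZ.
pose fL := GRing.isLinear.Build _ _ _ _ f0 f0_lin.
pose phi : {linear frobenius_root e charRp -> R^o} := HB.pack f0 fL.
by exists phi => r; rewrite -[RHS]mulr1 -fc; apply: fZ.
Qed.

(** No splitting of [L] is constructed. Denominators are cleared, and the splitting of [R] is
    applied to the contraction [J] of the ideal. *)
Lemma locally_weakly_F_regular_split : locally_weakly_F_regular R.
Proof.
move=> S L f [S1 SM] [fS Lf kerf].
have S_neq0 s : S s -> s <> 0.
  by move=> /fS[t] + s0; rewrite s0 rmorph0 mul0r => /esym/eqP; rewrite oner_eq0.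
have f_inj r : f r = 0 -> r = 0.
  by move=> /kerf[s /S_neq0 s0 /domR[]].
have domL (x y : L) : x * y = 0 -> x = 0 \/ y = 0.
  have [r [s [Ss xs]]] := Lf x; have [r' [s' [Ss' ys]]] := Lf y.
  move=> xy; have : f (r * r') = 0 by rewrite rmorphM -xs -ys mulrACA xy mul0r.
  have [t st] := fS _ Ss; have [t' st'] := fS _ Ss'.
  move=> /f_inj/domR[r0|r0]; [left|right].
    by rewrite -[x]mulr1 -st mulrA xs r0 rmorph0 mul0r.
  by rewrite -[y]mulr1 -st' mulrA ys r0 rmorph0 mul0r.
exists p; first exact: rmorph_pchar charRp.
move=> I idI u [c /(off_minimal_primes_neq0 domL) c0 [e0 tc]].
have [r [s [Ss cs]]] := Lf c; have [v [t [St ut]]] := Lf u.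
have r0 : r <> 0.
  move=> r0; have [s' ss'] := fS _ Ss; apply: c0.
  by rewrite -[c]mulr1 -ss' mulrA cs r0 rmorph0 mul0r.
have [e1 e1_gt0 re1] := splitR r0.
have [e le0e re] := splits_at_large e0 p_gt0 e1_gt0 re1.
pose J x := I (f x).
have idJ : ideal J.
  case: idI => I0 ID IM; split; rewrite /J ?rmorph0 //.
    by move=> x y Ix Iy; rewrite rmorphD; apply: ID.
  by move=> a x Ix; rewrite rmorphM; apply: IM.
set q := (p ^ e)%N in re.
have q_gt0 : (0 < q)%N by rewrite expn_gt0 p_gt0.
(* A finite sum has a common denominator. *)
have clear x : frobenius_power I q x ->
    exists2 a, S a & exists2 b, f b = f a * x & frobenius_power J q b.
  case=> l [lI ->]; elim: l lI => [|[z w] l IH] lI.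
    exists 1 => //; exists 0; first by rewrite big_nil mulr0 rmorph0.
    by exists [::]; rewrite big_nil.
  have [|a Sa [b bE Jb]] := IH; first by move=> h hl; apply: lI; rewrite inE hl orbT.
  have [y Iy /= ->] := lI _ (mem_head _ _).
  have [z1 [z2 [Sz2 zE]]] := Lf z; have [y1 [y2 [Sy2 yE]]] := Lf y.
  have Sy2q : S (y2 ^+ q) by elim: (q) => [|n Sn] //; rewrite exprS; apply: SM.
  exists (a * (z2 * y2 ^+ q)); first by apply: (SM) => //; apply: SM.
  exists (z2 * y2 ^+ q * b + a * z1 * y1 ^+ q).
    rewrite big_cons rmorphD 6!rmorphM bE /= !rmorphXn -zE -yE exprMn /=.
    by move: (\sum_(t <- l) _) (y ^+ q) (f y2 ^+ q) => A B C; ring.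
  case: (ideal_gen_ideal (fun x => exists2 y, J y & x = y ^+ q)) => _ JD JM.
  apply: JD; first exact: JM.
  apply: JM; apply: mem_ideal_gen; exists y1 => //.
  by rewrite /J -yE; apply: ideal_mulr.
have [a Sa [b bE Jb]] := clear _ (tc e le0e).
have fe x y : f x = f y -> x = y.
  by move=> xy; apply/eqP; rewrite -subr_eq0; apply/eqP/f_inj; rewrite rmorphB xy subrr.
(* Since f(r) = c s, f(v) = u t and f(b) = f(a) c u^q, the element r (a v)^q is a multiple of [b],
   which lies in J^[q]. *)
have Jv : J (a * v).
  apply: (splits_at_frobenius_power idJ re).
  have -> : r * (a * v) ^+ q = (a ^+ q.-1 * s * t ^+ q) * b.
    apply: fe; rewrite !rmorphM !rmorphXn rmorphM bE -ut -cs -/q !exprMn.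
    have -> : f a ^+ q = f a * f a ^+ q.-1 by rewrite -exprS prednK.
    by move: (f a ^+ _) (u ^+ _) (f t ^+ _) => A B C; ring.
  by case: (ideal_gen_ideal (fun x => exists2 y, J y & x = y ^+ q)) => _ _; apply.
have [a' aa'] := fS _ Sa; have [t' tt'] := fS _ St.
have -> : u = a' * t' * f (a * v).
  rewrite rmorphM -ut -[LHS]mulr1 -[LHS]mulr1 -{1}aa' -tt'; ring.
by case: idI => _ _; apply.
Qed.

Lemma is_localization_id : is_localization (fun x : R => x = 1) (@idfun R).
Proof.
split=> [s ->|z|r /= ->]; first by exists 1; rewrite mulr1.
  by exists z, 1; rewrite mulr1.
by exists 1; rewrite ?mulr0.
Qed.

Lemma F_regular_split v : F_regular v R.
Proof.
case: v; first exact: strongly_F_regular_split.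
  exact: locally_weakly_F_regular_split.
apply: (locally_weakly_F_regular_split _ is_localization_id).
by split=> // x y -> ->; rewrite mulr1.
Qed.

End FrobeniusSplitting.

(** View k as a vector space over its subfield of q-th powers. By Zorn's lemma there is a maximal
    subspace W without 1; it is a complement of the line through 1, and f(x) is the c with x - c^q
    in W. *)
Lemma field_frobenius_retraction (k : fieldType) (p : nat)
    (charkp : p \in [pchar k]) (e : nat) : splits_at (p ^ e) (1 : k).
Proof.
set q := (p ^ e)%N.
have q_gt0 : (0 < q)%N by rewrite expn_gt0 (prime_gt0 (pcharf_prime charkp)).
have qB (x y : k) : (x - y) ^+ q = x ^+ q - y ^+ q.
  apply/eqP; rewrite eq_sym subr_eq -(pchar_exprDpe e charkp).
  by rewrite subrK.
have qD (x y : k) : (x + y) ^+ q = x ^+ q + y ^+ q := pchar_exprDpe e charkp x y.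
pose P (W : classical_sets.set k) := [/\ forall x y, W x -> W y -> W (x + y),
  forall a x, W x -> W (a ^+ q * x) & ~ W 1].
have [|W [[WD WZ W1] Wmax]] := @classical_sets.Zorn_bigcup k P.
  move=> F FP Ftot; split.
  - move=> x y [U FU Ux] [V FV Vy].
    have [UV|VU] := Ftot _ _ FU FV.
      by exists V => //; have [VD _ _] := FP _ FV; apply: VD => //; apply: UV.
    by exists U => //; have [UD _ _] := FP _ FU; apply: UD => //; apply: VU.
  - by move=> a x [U FU Ux]; exists U => //; have [_ UZ _] := FP _ FU; apply: UZ.
  - by case=> U FU U1; have [_ _] := FP _ FU; apply.
(* [P] does not ask for 0, so that the union of the empty chain satisfies it. A [W] without 0 would
   be empty and hence not maximal, because of {0}. *)
have W0 : W 0.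
  apply: contrapT => nW0; apply: (Wmax (fun x => x = 0)).
    split; last by move=> h; apply: nW0; apply: h.
    by move=> x Wx; case: nW0; have := WZ 0 _ Wx; rewrite expr0n gtn_eqF //= mul0r.
  split=> [x y -> ->|a x ->|]; rewrite ?addr0 ?mulr0 //.
  by apply/eqP; rewrite oner_eq0.
have WN x : W x -> W (- x).
  move=> /(WZ (-1)); rewrite -[-1]sub0r qB expr0n gtn_eqF //= expr1n sub0r.
  by rewrite mulN1r.
have ex x : exists c, W (x - c ^+ q).
  have [Wx|nWx] := pselect (W x).
    by exists 0; rewrite expr0n gtn_eqF // subr0.
  (* This subspace is strictly larger than [W], so it contains 1; then 1 = w + c^q x is solved for x
     modulo [W]. *)
  pose V y := exists2 w, W w & exists c, y = w + c ^+ q * x.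
  have : ~ P V.
    apply: Wmax; split; last first.
      move=> h; apply: nWx; apply: h; exists 0 => //.
      by exists 1; rewrite expr1n mul1r add0r.
    by move=> y Wy; exists y => //; exists 0; rewrite expr0n gtn_eqF // mul0r addr0.
  move=> nPV; have [[w Ww [c wc]]|nV1] := pselect (V 1).
    have c0 : c != 0.
      apply/eqP => c0; apply: W1.
      by rewrite wc c0 expr0n gtn_eqF // mul0r addr0.
    exists c^-1; have -> : x - c^-1 ^+ q = - (c^-1 ^+ q * w).
      have -> : w = 1 - c ^+ q * x by rewrite wc addrK.
      rewrite mulrBr mulr1 mulrA -exprMn mulVf // expr1n mul1r.
      by rewrite opprB.
    exact/WN/WZ.
  case: nPV; split=> //.
    move=> y z [w Ww [c ->]] [w' Ww' [c' ->]]; exists (w + w'); first exact: WD.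
    by exists (c + c'); rewrite qD mulrDl addrACA.
  move=> a y [w Ww [c ->]]; exists (a ^+ q * w); first exact: WZ.
  by exists (a * c); rewrite exprMn mulrDr mulrA.
have uniq_c x c d : W (x - c ^+ q) -> W (x - d ^+ q) -> c = d.
  move=> /WN Wc Wd; apply/eqP; rewrite -subr_eq0; apply/negP => /negP cd.
  apply: W1; have /(WZ (c - d)^-1) := WD _ _ Wc Wd.
  by rewrite opprB addrA subrK -qB -exprMn mulVf // expr1n.
pose f x := proj1_sig (cid (ex x)).
have fP x : W (x - f x ^+ q) by rewrite /f; case: cid.
have fE x c : W (x - c ^+ q) -> f x = c by apply: uniq_c.
exists f; last by apply: fE; rewrite expr1n subrr.
split=> [x y|a x]; apply: fE.
  by rewrite qD opprD addrACA; apply: WD.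
by rewrite exprMn -mulrBr; apply: WZ.
Qed.

(** * A criterion for polynomial rings *)

Section Trace.
Variables (k : fieldType) (N : nat) (p : nat).
Hypothesis charkp : p \in [pchar k].
Local Notation S := {mpoly k[N]}.

Lemma mpoly_ind_mon (P : S -> Prop) :
  P 0 -> (forall f g, P f -> P g -> P (f + g)) ->
  (forall c m, P (c *: 'X_[m])) -> forall f, P f.
Proof. by move=> P0 PD PM f; rewrite (mpolyE f); elim/big_ind: _. Qed.

Let q_gt0 e : (0 < p ^ e)%N.
Proof. by rewrite expn_gt0 (prime_gt0 (pcharf_prime charkp)). Qed.

(* The exponents of the monomials whose q-th root the trace does not kill: it
   sends the q-th root of z^(top_mnm q b) to z^b. *)
Definition top_mnm (q : nat) (b : 'X_{1..N}) : 'X_{1..N} :=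
  [multinom (q.-1 + q * b i)%N | i < N].

Lemma top_mnm_inj q : (0 < q)%N -> injective (top_mnm q).
Proof.
move=> q0 b c /mnmP bc; apply/mnmP => i; have := bc i; rewrite !mnmE.
by move=> /addnI/eqP; rewrite eqn_pmul2l // => /eqP.
Qed.

(** Since k need not be perfect, coefficients have no q-th roots in general; the retraction [l] of
    the Frobenius of k replaces the root. *)
Lemma trace_ex e : exists2 T : S -> S, root_linear (p ^ e) T &
  exists2 l : k -> k, l 1 = 1 &
  forall f b, (T f)@_b = l f@_(top_mnm (p ^ e) b).
Proof.
set q := (p ^ e)%N.
have [l lq l1] := field_frobenius_retraction charkp e.
(* The bound on b loses nothing: [top_mnm q b] has at least the degree of b. *)
pose T (f : S) : S := \sum_(b : 'X_{1..N < msize f})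
  l f@_(top_mnm q b) *: 'X_[b].
have TE f b : (T f)@_b = l f@_(top_mnm q b).
  have [lt|ge] := ltnP (mdeg b) (msize f).
    exact: (mcoeff_mpoly (fun b => l f@_(top_mnm q b)) lt).
  have deg_top : (mdeg b <= mdeg (top_mnm q b))%N.
    rewrite !mdegE leq_sum // => i _; rewrite mnmE.
    by rewrite (leq_trans (leq_pmull (b i) (q_gt0 e))) // leq_addl.
  have -> : f@_(top_mnm q b) = 0.
    by apply: memN_msupp_eq0; apply: msize_mdeg_ge; apply: leq_trans deg_top.
  rewrite (root_linear0 lq) /T raddf_sum big1 // => c _.
  rewrite /= mcoeffZ mcoeffX; case: eqP => [cb|_]; last by rewrite mulr0.
  by move: (bmdeg c) ge; rewrite cb; lia.
have TD f g : T (f + g) = T f + T g.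
  by apply/mpolyP => b; rewrite mcoeffD !TE mcoeffD lq.1.
exists T; last by exists l.
split=> // a x.
have charSp : p \in [pchar S] by rewrite pchar_lalg.
move: a; apply: mpoly_ind_mon => [|f g IHf IHg|c m].
- by rewrite expr0n gtn_eqF ?q_gt0 //= !mul0r; apply/mpolyP => b;
    rewrite TE !mcoeff0 (root_linear0 lq).
- by rewrite (pchar_exprDpe e charSp) mulrDl TD IHf IHg mulrDl.
move: x; apply: mpoly_ind_mon => [|f g IHf IHg|d m'].
- have T0 : T 0 = 0 by apply/mpolyP => b;
    rewrite TE !mcoeff0 (root_linear0 lq).
  by rewrite mulr0 T0 mulr0.
- by rewrite mulrDr !TD [LHS](f_equal2 +%R IHf IHg) mulrDr.
have Tmon a u b : (T (a *: 'X_[u]))@_b = l (a * (u == top_mnm q b)%:R).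
  by rewrite TE mcoeffZ mcoeffX.
have topD b : (m *+ q + top_mnm q b)%MM = top_mnm q (m + b)%MM.
  by apply/mnmP => i; rewrite mnmDE mulmnE !mnmE; lia.
have -> : (c *: 'X_[m]) ^+ q * (d *: 'X_[m']) = (c ^+ q * d) *: 'X_[(m *+ q + m')].
  by rewrite exprZn -scalerAl -scalerAr scalerA mpolyXn -mpolyXD.
have [[b' m'E]|nm'] := pselect (exists b', m' = top_mnm q b').
  have -> : T (d *: 'X_[m']) = l d *: 'X_[b'].
    apply/mpolyP => b; rewrite Tmon mcoeffZ mcoeffX m'E (inj_eq (top_mnm_inj (q_gt0 e))).
    by case: eqP; rewrite ?mulr1 ?mulr0 ?(root_linear0 lq).
  rewrite -scalerAl -scalerAr scalerA -mpolyXD; apply/mpolyP => b.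
  rewrite Tmon mcoeffZ mcoeffX m'E topD (inj_eq (top_mnm_inj (q_gt0 e))).
  by case: eqP; rewrite ?mulr1 ?mulr0 ?(root_linear0 lq) ?lq.2.
have -> : T (d *: 'X_[m']) = 0.
  apply/mpolyP => b; rewrite Tmon mcoeff0; case: eqP => [m'E|_].
    by case: nm'; exists b.
  by rewrite mulr0 (root_linear0 lq).
(* If q m + m' were [top_mnm q b], then m <= b, and m' would be [top_mnm q] of b - m. *)
apply/mpolyP => b; rewrite mulr0 mcoeff0 Tmon; case: eqP => [mE|_].
  case: nm'; exists (b - m)%MM; apply/mnmP => i.
  move/mnmP/(_ i): mE; rewrite mnmDE mulmnE !mnmE; move: (q_gt0 e) => q0.
  rewrite -/q in q0 *; rewrite mulnBr mulnC => mE.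
  have : (q * m i < q * (b i).+1)%N by lia.
  by rewrite ltn_pmul2l // ltnS => mb; have := leq_mul (leqnn q) mb; lia.
by rewrite mulr0 (root_linear0 lq).
Qed.

(** * Polynomials in which a variable does not occur, and their traces *)

Definition free_of (z : 'I_N) (f : S) : bool :=
  all (fun m : 'X_{1..N} => m z == 0%N) (msupp f).

Lemma freeP z f :
  reflect (forall m : 'X_{1..N}, m \in msupp f -> m z = 0%N) (free_of z f).
Proof. by apply: (iffP allP) => h m /h /eqP. Qed.

Lemma freeC z c : free_of z c%:MP.
Proof.
apply/freeP => m; rewrite msuppC; case: eqP => // _; rewrite inE => /eqP ->.
by rewrite mnm0E.
Qed.

Lemma free0 z : free_of z 0.
Proof. by rewrite -mpolyC0 freeC. Qed.

Lemma free1 z : free_of z 1.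
Proof. by rewrite -mpolyC1 freeC. Qed.

Lemma freeXm z (m : 'X_{1..N}) : m z = 0%N -> free_of z 'X_[m].
Proof. by move=> mz; apply/freeP => m'; rewrite msuppX inE => /eqP ->. Qed.

Lemma freeXU z z' : z' != z -> free_of z 'X_z'.
Proof. by move=> zz; rewrite freeXm // mnm1E (negPf zz). Qed.

Lemma freeD z f g : free_of z f -> free_of z g -> free_of z (f + g).
Proof.
move=> /freeP zf /freeP zg; apply/freeP => m /msuppD_le.
by rewrite mem_cat => /orP[/zf|/zg].
Qed.

Lemma freeM z f g : free_of z f -> free_of z g -> free_of z (f * g).
Proof.
move=> /freeP zf /freeP zg; apply/freeP => m /msuppM_le/allpairsP[[a b] /= [/zf za /zg zb ->]].
by rewrite mnmDE za zb.
Qed.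

Lemma freeN z f : free_of z f -> free_of z (- f).
Proof. by rewrite -mulN1r -mpolyC1 -mpolyCN; apply/freeM/freeC. Qed.

Lemma freeB z f g : free_of z f -> free_of z g -> free_of z (f - g).
Proof. by move=> zf /freeN; apply: freeD. Qed.

Lemma freeX z f n : free_of z f -> free_of z (f ^+ n).
Proof. by move=> zf; elim: n => [|n IH]; rewrite ?free1 // exprS freeM. Qed.

Lemma free_prod z (T : eqType) (s : seq T) (F : T -> S) :
  (forall t, t \in s -> free_of z (F t)) -> free_of z (\prod_(t <- s) F t).
Proof.
by move=> zF; rewrite big_seq; elim/big_ind: _; [exact: free1|exact: freeM|].
Qed.

Lemma free_sum z (T : finType) (P : pred T) (F : T -> S) :
  (forall t, P t -> free_of z (F t)) -> free_of z (\sum_(t | P t) F t).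
Proof. by move=> zF; elim/big_ind: _; [exact: free0|exact: freeD|]. Qed.

Section WithTrace.
Variables (e : nat) (T : S -> S) (l : k -> k).
Local Notation q := (p ^ e)%N.
Hypothesis (Tq : root_linear q T) (l1 : l 1 = 1).
Hypothesis TE : forall f b, (T f)@_b = l f@_(top_mnm q b).

Let l0 : l 0 = 0.
Proof. by have := TE 0 0; rewrite (root_linear0 Tq) !mcoeff0. Qed.

(** The monomial factor moves [mu] to the exponent q - 1 in every variable; after that the trace
    sees only the coefficients of [f] at mu + q b. *)
Lemma trace_eq1 (f : S) (mu : 'X_{1..N}) :
  (forall i, (mu i < q)%N) -> f@_mu != 0 ->
  (forall b : 'X_{1..N}, b != 0%MM -> f@_(mu + b *+ q)%MM = 0) ->
  T ((f@_mu)^-1 *: 'X_[(top_mnm q 0 - mu)] * f) = 1.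
Proof.
move=> mu_lt f0 fb; apply/mpolyP => b; rewrite TE mcoeff1 -scalerAl mcoeffZ.
have -> : top_mnm q b = (top_mnm q 0 - mu + (mu + b *+ q))%MM.
  apply/mnmP => i; rewrite !(mnmDE, mnmBE, mulmnE, mnmE) muln0 addn0.
  by have := mu_lt i; have := q_gt0 e; rewrite mulnC; lia.
rewrite (mulrC 'X_[_]) mcoeffMX; have [->|b0] := eqVneq b 0%MM; last by rewrite fb ?mulr0 ?l0.
have -> : (mu + 0 *+ q)%MM = mu by apply/mnmP => i; rewrite mnmDE mulmnE mnm0E mul0n addn0.
by rewrite mulVf // l1.
Qed.

Lemma trace_low z f j : (j < q.-1)%N -> free_of z f -> T ('X_z ^+ j * f) = 0.
Proof.
move=> jq /freeP zf; apply/mpolyP => b; rewrite TE mcoeff0 memN_msupp_eq0 //.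
apply/negP => /msuppM_le/allpairsP[[a c] /= [+ /zf cz /mnmP/(_ z)]].
rewrite mpolyXn msuppX inE => /eqP ->.
by rewrite mnmDE cz addn0 mulmnE mnm1E eqxx mul1n mnmE; lia.
Qed.

(* In the expansion only the leading term in z has exponent -1 modulo q in z. *)
Lemma trace_linear_power z d r f :
  free_of z d -> free_of z r -> free_of z f ->
  T ((d * 'X_z + r) ^+ q.-1 * f) = T ((d * 'X_z) ^+ q.-1 * f).
Proof.
move=> zd zr zf; rewrite exprDn big_ord_recl bin0 mulr1n expr0 mulr1 subn0.
rewrite mulrDl Tq.1 mulr_suml (root_linear_sum _ _ Tq) big1 ?addr0 // => i _ /=.
set j := (_ - _)%N; set c := 'C(_, _).
have -> : ((d * 'X_z) ^+ j * r ^+ bump 0 i) *+ c * f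
        = 'X_z ^+ j * (d ^+ j * r ^+ bump 0 i * c%:R * f).
  by rewrite exprMn -mulr_natr; ring.
rewrite trace_low //; first by rewrite /j /bump; have := ltn_ord i; lia.
by rewrite !freeM ?freeX // -mpolyC_nat freeC.
Qed.

(** The last g are replaced first: the earlier ones are free of their variables, and by the time g
    is treated, the later factors have become products d' z' free of z. *)
Lemma trace_elim (s : seq (S * S * 'I_N)) u :
  uniq [seq t.2 | t <- s] ->
  pairwise (fun t t' => free_of t'.2 t.1.1) s ->
  (forall t, t \in s -> free_of t.2 (t.1.1 - t.1.2 * 'X_t.2)) ->
  (forall t t', t \in s -> t' \in s -> free_of t'.2 t.1.2) ->
  (forall t, t \in s -> free_of t.2 u) ->
  T (\prod_(t <- s) t.1.1 ^+ q.-1 * u) =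
  T (\prod_(t <- s) (t.1.2 * 'X_t.2) ^+ q.-1 * u).
Proof.
elim: s u => [|[[g d] z] s IH] u; first by rewrite !big_nil.
rewrite map_cons cons_uniq pairwise_cons => /andP[zs us] /andP[/allP gs ps] res ds us'.
rewrite !big_cons /= [X in T X]mulrAC [X in T X]mulrC IH //; first last.
- by move=> t ts; rewrite freeM ?freeX ?gs ?us' // inE ts orbT.
- by move=> t t' ts t's; apply: ds; rewrite inE ?ts ?t's orbT.
- by move=> t ts; apply: res; rewrite inE ts orbT.
rewrite mulrCA -{1}(subrK (d * 'X_z) g) addrC trace_linear_power.
- by rewrite mulrA.
- by apply: (ds (g, d, z) (g, d, z)); rewrite mem_head.
- by apply: (res (g, d, z)); rewrite mem_head.
rewrite freeM ?(us' (g, d, z)) ?mem_head //; apply: free_prod => t ts.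
rewrite freeX // freeM ?(ds t (g, d, z)) ?mem_head ?inE ?ts ?orbT // freeXU //.
by apply: contraNneq zs => <-; apply/mapP; exists t.
Qed.

End WithTrace.

(** * The criterion: elimination of variables, primality and splittings modulo I *)

Section Criterion.
(** The list [s] holds the triples (g, d, z) with g = d z + r. The extra factor [w] of D is there
    for ideals that the product of the g^(q-1) alone does not multiply into I^[q]. *)
Variables (I : S -> Prop) (s : seq (S * S * 'I_N)) (w : S).
Hypotheses (idI : ideal I) (properI : ~ I 1).
Hypothesis s_uniq : uniq [seq t.2 | t <- s].
Hypothesis s_pairwise : pairwise (fun t t' => free_of t'.2 t.1.1) s.
Hypothesis s_rest : forall t, t \in s -> free_of t.2 (t.1.1 - t.1.2 * 'X_t.2).
Hypothesis s_coef : forall t t', t \in s -> t' \in s -> free_of t'.2 t.1.2.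
Hypothesis s_ideal : forall t, t \in s -> I t.1.1.
Hypothesis s_free_w : forall t, t \in s -> free_of t.2 w.
Local Notation D := (w * \prod_(t <- s) t.1.2).
Hypothesis s_mult : forall e y, I y ->
  frobenius_power I (p ^ e) (w * \prod_(t <- s) t.1.1 ^+ (p ^ e).-1 * y).
Variables (e0 : nat) (F : S) (mu : 'X_{1..N}).
Hypothesis e0_gt0 : (0 < e0)%N.
Hypothesis F_mult : forall y, I y -> frobenius_power I (p ^ e0) (F * y).
Hypothesis mu_lt : forall i, (mu i < p ^ e0)%N.
Hypothesis FD_mu : (F * D)@_mu != 0.
Hypothesis FD_uniq : forall b : 'X_{1..N}, b != 0%MM ->
  (F * D)@_(mu + b *+ (p ^ e0))%MM = 0.

(** This is what lets a semilinear map descend to S/I. *)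
Definition preserves (f : S -> S) := forall x, I x -> I (f x).

Lemma trace_mul_preserves e T h : root_linear (p ^ e) T ->
  (forall y, I y -> frobenius_power I (p ^ e) (h * y)) ->
  preserves (fun x => T (h * x)).
Proof. by move=> Tq hI x /hI; apply: root_linear_frobenius_power. Qed.

Lemma ideal_frobenius_power q : ideal (frobenius_power I q).
Proof. exact: ideal_gen_ideal. Qed.

Lemma split_D : exists2 f, root_linear (p ^ e0) f /\ preserves f & f D = 1.
Proof.
have [T Tq [l l1 TE]] := trace_ex e0.
pose h := ((F * D)@_mu)^-1 *: 'X_[(top_mnm (p ^ e0) 0 - mu)].
exists (fun x => T (h * F * x)); last by rewrite -mulrA (trace_eq1 Tq l1 TE).
split; first exact: root_linear_mul.
apply: trace_mul_preserves Tq _ => y Iy; rewrite -mulrA.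
by case: (ideal_frobenius_power (p ^ e0)) => _ _; apply; apply: F_mult.
Qed.

Lemma free_coef t : t \in s -> free_of t.2 (\prod_(t' <- s) t'.1.2).
Proof. by move=> ts; apply: free_prod => t' t's; apply: s_coef. Qed.

Lemma free_D t : t \in s -> free_of t.2 D.
Proof. by move=> ts; rewrite freeM ?s_free_w ?free_coef. Qed.

(** The multiplier is w prod g^(q-1) times a cofactor that completes w to w^q, each d^(q-1) to d^q,
    and the leading monomial of [b] to exponents q - 1. The trace then extracts w and the d's, whose
    product is D. *)
Lemma map_to_D b : b != 0 -> (forall t, t \in s -> free_of t.2 b) ->
  exists2 e, (0 < e)%N & exists2 f, root_linear (p ^ e) f /\ preserves f & f b = D.
Proof.
(* With this [e], p^e exceeds the degree of the leading monomial, hence each of its exponents. *)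
move=> b0 sb; pose e := (mdeg (mlead b)).+1.
set q := (p ^ e)%N; have q0 : (0 < q)%N := q_gt0 e.
have lead_lt i : (mlead b i < q)%N.
  apply: (@leq_ltn_trans (mdeg (mlead b))).
    by rewrite mdegE (bigD1 i) //= leq_addr.
  apply: ltn_trans (ltnSn _) _; apply: ltn_expl.
  exact: prime_gt1 (pcharf_prime charkp).
have [T Tq [l l1 TE]] := trace_ex e.
have b_lead : b@_(mlead b) != 0 by rewrite mleadc_eq0.
have b_uniq c : c != 0%MM -> b@_(mlead b + c *+ q)%MM = 0.
  move=> c0; apply: mcoeff_gt_mlead; apply: lt_mdeg_ltmc.
  rewrite mdegD mdegMn -[X in (X < _)%N]addn0 ltn_add2l muln_gt0 q0 andbT.
  by rewrite lt0n mdeg_eq0.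
pose r := [multinom if i \in [seq t.2 | t <- s] then 0%N
                    else (q.-1 - mlead b i)%N | i < N].
(* In an eliminated variable z the polynomial [b] has exponent 0, and the whole q - 1 is supplied by
   z^(q-1) from the g's. *)
have top_split : (top_mnm q 0 - mlead b)%MM =
    (\sum_(t <- s) U_(t.2) *+ q.-1 + r)%MM.
  apply/mnmP => i; rewrite mnmDE mnm_sumE mnmBE !mnmE muln0 addn0.
  have -> : (\sum_(t <- s) (U_(t.2) *+ q.-1)%MM i)%N
          = ((i \in [seq t.2 | t <- s]) * q.-1)%N.
    transitivity (\sum_(z <- [seq t.2 | t <- s]) (z == i) * q.-1)%N.
      by rewrite big_map; apply: eq_bigr => t _; rewrite mulmnE mnm1E.
    rewrite -big_distrl /= -count_uniq_mem // -sum1_count [in RHS]big_mkcond.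
    by congr (_ * _)%N; apply: eq_bigr => z _ /=; case: (z == i).
  case: ifP => [/mapP[t ts ->]|_]; rewrite ?mul0n //= mul1n addn0.
  have /freeP -> := sb t ts; last by rewrite mlead_supp.
  by rewrite subn0.
pose u := (b@_(mlead b))^-1 *: 'X_[r].
pose G := w * \prod_(t <- s) t.1.1 ^+ q.-1.
pose c := w ^+ q.-1 * \prod_(t <- s) t.1.2 * u.
exists e => //; exists (fun x => T (c * G * x)).
  split; first exact: root_linear_mul.
  apply: trace_mul_preserves Tq _ => y Iy; rewrite -mulrA.
  by case: (ideal_frobenius_power q) => _ _; apply; apply: s_mult.
have -> : c * G * b = w ^+ q *
    (\prod_(t <- s) t.1.1 ^+ q.-1 * ((\prod_(t <- s) t.1.2) * u * b)).
  rewrite /c /G -(prednK q0) exprS prednK //=.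
  by move: (\prod_(t <- s) _) (\prod_(t <- s) _) (w ^+ _) => A B C; ring.
rewrite Tq.2 (trace_elim Tq TE) //; last first.
  move=> t ts; rewrite !freeM ?free_coef ?sb // /u -mul_mpolyC freeM ?freeC //.
  by rewrite freeXm // mnmE map_f.
congr (_ * _).
have -> : \prod_(t <- s) (t.1.2 * 'X_t.2) ^+ q.-1 * (\prod_(t <- s) t.1.2 * u * b)
    = (\prod_(t <- s) t.1.2) ^+ q *
      ((b@_(mlead b))^-1 *: 'X_[(top_mnm q 0 - mlead b)] * b).
  under eq_bigr do rewrite exprMn.
  rewrite big_split /= prodrXl top_split mpolyXD /u.
  have -> : 'X_[k, (\sum_(t <- s) U_(t.2) *+ q.-1)%MM] = \prod_(t <- s) 'X_t.2 ^+ q.-1.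
    by rewrite -mprodXE; apply: eq_bigr => t _; rewrite mpolyXn.
  rewrite -[in RHS](prednK q0) exprS -!mul_mpolyC.
  by move: (\prod_(t <- s) _) (\prod_(t <- s) _ ) (_ ^+ _) => A B C; ring.
by rewrite Tq.2 (trace_eq1 Tq l1 TE) ?mulr1.
Qed.

(* If D x is in I, then so is D x^q, which a semilinear map sending D to 1 maps
   to x. *)
Lemma ideal_colon_D M x : I (D ^+ M * x) -> I x.
Proof.
elim: M x => [|M IH] x; first by rewrite expr0 mul1r.
rewrite exprS -mulrA => /[dup] _ IDx; apply: IH; move: IDx.
move: (_ ^+ M * x) => {}x IDx.
have [f [fq fI] fD] := split_D.
suff : I (f (D * x ^+ (p ^ e0))) by rewrite mulrC fq.2 fD mulr1.
apply: fI; rewrite -(prednK (q_gt0 e0)) exprS mulrA.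
exact: ideal_mulr.
Qed.

Definition eliminable f := exists M, exists2 b,
  (forall t, t \in s -> free_of t.2 b) & I (D ^+ M * f - b).

Lemma eliminable_free f : (forall t, t \in s -> free_of t.2 f) -> eliminable f.
Proof.
by move=> sf; exists 0%N, f => //; rewrite expr0 mul1r subrr; case: idI.
Qed.

Lemma eliminableD f g : eliminable f -> eliminable g -> eliminable (f + g).
Proof.
move=> [M [b sb Ib]] [M' [b' sb' Ib']]; exists (M + M')%N, (D ^+ M' * b + D ^+ M * b').
  by move=> t ts; rewrite freeD ?freeM ?freeX ?free_D ?sb ?sb'.
have -> : D ^+ (M + M') * (f + g) - (D ^+ M' * b + D ^+ M * b') =
  D ^+ M' * (D ^+ M * f - b) + D ^+ M * (D ^+ M' * g - b').
  by rewrite exprD; move: (D ^+ M) (D ^+ M') => A B; ring.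
by case: idI => _ ID IM; apply: ID; apply: IM.
Qed.

Lemma eliminableM f g : eliminable f -> eliminable g -> eliminable (f * g).
Proof.
move=> [M [b sb Ib]] [M' [b' sb' Ib']]; exists (M + M')%N, (b * b').
  by move=> t ts; rewrite freeM ?sb ?sb'.
have -> : D ^+ (M + M') * (f * g) - b * b' =
  (D ^+ M' * g) * (D ^+ M * f - b) + b * (D ^+ M' * g - b').
  by rewrite exprD; move: (D ^+ M) (D ^+ M') => A B; ring.
by case: idI => _ ID IM; apply: ID; apply: IM.
Qed.

Lemma eliminable_vars f :
  (forall z, ~~ free_of z f -> eliminable 'X_z) -> eliminable f.
Proof.
move=> Hf; rewrite (mpolyE f) big_seq; elim/big_ind: _ => [||m mf].
- by apply: eliminable_free => t _; apply: free0.
- exact: eliminableD.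
rewrite -mul_mpolyC; apply: eliminableM.
  by apply: eliminable_free => t _; apply: freeC.
rewrite mpolyXE_id; elim/big_ind: _ => [||z _].
- by apply: eliminable_free => t _; apply: free1.
- exact: eliminableM.
have [->|mz] := eqVneq (m z) 0%N.
  by rewrite expr0; apply: eliminable_free => t _; apply: free1.
have Xz : eliminable 'X_z.
  by apply: Hf; apply: contra mz => /freeP/(_ m mf)/eqP.
elim: (m z) => [|n IH]; last by rewrite exprS; apply: eliminableM.
by rewrite expr0; apply: eliminable_free => t _; apply: free1.
Qed.

(** Pivots are solved in the order of the list. The remainder r = g - d z involves neither z nor the
    variables of later pivots, so it is already eliminable, and d z is -r modulo I. *)
Lemma eliminable_all f : eliminable f.
Proof.
suff H : forall z, eliminable 'X_z by apply: eliminable_vars.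
suff : forall s', {subset s' <= s} -> pairwise (fun t t' => free_of t'.2 t.1.1) s' ->
    (forall z, z \notin [seq t.2 | t <- s'] -> eliminable 'X_z) ->
    forall z, eliminable 'X_z.
  move/(_ s); apply=> // z zs; apply: eliminable_free => t ts.
  by apply: freeXU; apply: contraNneq zs => ->; apply: map_f.
elim=> [|[[g d] z0] s' IH] sub; first by move=> _ H z1; apply: H.
rewrite pairwise_cons => /andP[/allP gs' ps'] H.
apply: IH => // [t ts|z1 z1s]; first by apply: sub; rewrite inE ts orbT.
have t0s : (g, d, z0) \in s by apply: sub; rewrite mem_head.
have [z10|z10] := eqVneq z1 z0; last by apply: H; rewrite /= inE negb_or z10.
have := s_rest t0s; rewrite /=; set r := g - _ => z0r.
have [M [b sb Ib]] : eliminable r.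
  apply: eliminable_vars => z zr; apply: H; rewrite /= inE negb_or.
  apply/andP; split; first by apply: contraNneq zr => ->.
  apply: contra zr => /mapP[t ts ->]; rewrite freeB ?(gs' t) // freeM //.
    by apply: (s_coef t0s); apply: sub; rewrite inE ts orbT.
  rewrite freeXU //; apply: contraNneq z1s => z0t.
  by rewrite z10 z0t map_f.
have [D' D'E] : exists2 D', (forall t, t \in s -> free_of t.2 D') & D = D' * d.
  exists (w * \prod_(t <- rem (g, d, z0) s) t.1.2).
    move=> t ts; rewrite freeM ?s_free_w // free_prod // => t' /mem_rem t's.
    exact: s_coef.
  by rewrite (perm_big _ (perm_to_rem t0s)) big_cons /=; ring.
move=> DE; exists M.+1, (- (D' * b)).
  by move=> t ts; rewrite freeN // freeM ?D'E ?sb.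
have -> : D ^+ M.+1 * 'X_z1 - - (D' * b) =
    D' * D ^+ M * g - D' * (D ^+ M * r - b).
  by rewrite exprS /r z10 {1}DE; move: (D ^+ M) => A; ring.
by apply: idealB => //; case: (idI) => _ _ IM; apply: IM => //; apply: (s_ideal t0s).
Qed.

(** If b were 0, then D^M f and hence f would lie in I. The map sends b to D and then D to 1. *)
Lemma notin_ideal_map_to_D f : ~ I f -> exists M, exists2 b,
  [/\ b != 0, forall t, t \in s -> free_of t.2 b & I (D ^+ M * f - b)] &
  exists2 e, (0 < e)%N &
  exists2 g, root_linear (p ^ e) g /\ preserves g & g b = 1.
Proof.
move=> nIf; have [M [b sb Ib]] := eliminable_all f; exists M, b.
  split=> //; apply/eqP => b0; apply: nIf; apply: (@ideal_colon_D M).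
  by move: Ib; rewrite b0 subr0.
have b0 : b != 0.
  apply/eqP => b0; apply: nIf; apply: (@ideal_colon_D M).
  by move: Ib; rewrite b0 subr0.
have [e e_gt0 [g [gq gI] gb]] := map_to_D b0 sb.
have [f' [f'q f'I] f'D] := split_D.
exists (e0 + e)%N; first by rewrite addn_gt0 e_gt0 orbT.
exists (fun x => f' (g x)); last by rewrite gb.
by rewrite expnD; split; [apply: root_linear_comp|move=> x /gI/f'I].
Qed.

(** If neither factor is in I, the product b b' of their reductions is nonzero, and a map preserving
    I sends it to 1; but b b' lies in I. *)
Lemma criterion_prime f g : I (f * g) -> I f \/ I g.
Proof.
move=> Ifg; have [|nIf] := pselect (I f); first by left.
have [|nIg] := pselect (I g); [by right|exfalso].
have [M [b [b0 sb Ib] _]] := notin_ideal_map_to_D nIf.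
have [M' [b' [b'0 sb' Ib'] _]] := notin_ideal_map_to_D nIg.
have Ibb : I (b * b').
  have -> : b * b' = D ^+ (M + M') * (f * g) - (D ^+ M' * g) * (D ^+ M * f - b)
     - b * (D ^+ M' * g - b').
    by rewrite exprD; move: (D ^+ M) (D ^+ M') => A B; ring.
  by case: (idI) => _ _ IM; do 2?apply: idealB => //; apply: IM.
have [|t ts|e _ [h [hq hI] hb]] := @map_to_D (b * b').
- by rewrite mulf_neq0.
- by rewrite freeM ?sb ?sb'.
have [f' [f'q f'I] f'D] := split_D.
by apply: properI; rewrite -f'D -hb; apply/f'I/hI.
Qed.

Lemma criterion_split f : ~ I f -> exists2 e, (0 < e)%N &
  exists2 h, root_linear (p ^ e) h /\ preserves h & I (h f - 1).
Proof.
move=> /notin_ideal_map_to_D[M [b [b0 sb Ib] [e e_gt0 [g [gq gI] gb]]]].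
exists e => //; exists (fun x => g (D ^+ M * x)).
  split; first exact: root_linear_mul.
  by move=> x Ix; apply: gI; case: idI => _ _; apply.
have gB : g (D ^+ M * f) - g b = g (D ^+ M * f - b).
  by apply/eqP; rewrite subr_eq -gq.1 subrK.
by rewrite gb in gB; rewrite gB; apply: gI.
Qed.

End Criterion.
End Trace.

(** * Descent of semilinear maps to the quotient ring *)

Section IdealQuotient.
Variables (S : comNzRingType) (J : idealr S) (p : nat).
Local Notation R := {ideal_quot J}.

Lemma ideal_quot_eq0 (x : S) : (\pi_R x = 0)%qT <-> x \in (J : {pred S}).
Proof.
rewrite -[0](rmorph0 (\pi_R)%qT) -[x in x \in _]subr0.
by rewrite Quotient.idealrBE; split=> /eqP.
Qed.

Lemma ideal_quot_repr (x : S) : x - repr (\pi_R x)%qT \in (J : {pred S}).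
Proof. by rewrite Quotient.idealrBE reprK. Qed.

Hypothesis charSp : p \in [pchar S].
Hypothesis primeJ :
  forall x y, x * y \in (J : {pred S}) -> x \in (J : {pred S}) \/ y \in (J : {pred S}).
Hypothesis splitJ : forall x, x \notin (J : {pred S}) -> exists2 e, (0 < e)%N &
  exists2 h, root_linear (p ^ e) h /\ (forall y, y \in (J : {pred S}) -> h y \in (J : {pred S}))
    & h x - 1 \in (J : {pred S}).

Lemma ideal_quot_F_regular v : F_regular v R.
Proof.
have charRp : p \in [pchar R] := rmorph_pchar (\pi_R)%qT charSp.
have piE (x : R) : x = (\pi_R (repr x))%qT by rewrite reprK.
apply: (F_regular_split charRp) => [x y|c c0].
  rewrite (piE x) (piE y) -rmorphM => /ideal_quot_eq0/primeJ.
  by case=> /ideal_quot_eq0; [left|right].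
have /splitJ[e e_gt0 [h [hq hJ] hc]] : repr c \notin (J : {pred S}).
  by apply/negP => /ideal_quot_eq0; rewrite reprK.
have h_pi x y : (\pi_R x = \pi_R y)%qT -> (\pi_R (h x) = \pi_R (h y))%qT.
  move=> /eqP; rewrite -Quotient.idealrBE => /hJ.
  have -> : h (x - y) = h x - h y by apply/eqP; rewrite eq_sym subr_eq -hq.1 subrK.
  by rewrite Quotient.idealrBE => /eqP.
exists e => //; exists (fun x => \pi_R (h (repr x)))%qT; last first.
  by rewrite /= -[RHS](rmorph1 (\pi_R)%qT); apply/eqP; rewrite -Quotient.idealrBE.
have piD (x y : S) : (\pi_R (x + y) = \pi_R x + \pi_R y)%qT := rmorphD _ x y.
have piM (x y : S) : (\pi_R (x * y) = \pi_R x * \pi_R y)%qT := rmorphM _ x y.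
have piX (x : S) n : (\pi_R (x ^+ n) = \pi_R x ^+ n)%qT := rmorphXn _ n x.
split=> [x y|a x] /=.
  by rewrite -piD -hq.1; apply: h_pi; rewrite piD !reprK.
by rewrite {2}(piE a) -piM -hq.2; apply: h_pi; rewrite piM piX !reprK.
Qed.

End IdealQuotient.

(** * Leading monomials *)

Section TopMonomials.
Variables (k : fieldType) (N : nat) (wt : 'I_N -> nat).
Local Notation S := {mpoly k[N]}.

Definition wdeg (m : 'X_{1..N}) : nat := \sum_i wt i * m i.

Lemma wdegD m m' : wdeg (m + m') = (wdeg m + wdeg m')%N.
Proof.
by rewrite /wdeg -big_split; apply: eq_bigr => i _; rewrite mnmDE mulnDr.
Qed.

Lemma wdegU i : wdeg U_(i) = wt i.
Proof.
rewrite /wdeg (bigD1 i) //= mnm1E eqxx muln1 big1 ?addn0 // => j ji.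
by rewrite mnm1E eq_sym (negPf ji) muln0.
Qed.

Definition lower (W : nat) (f : S) : Prop :=
  forall m, m \in msupp f -> (wdeg m < W)%N.

Lemma lower0 W : lower W 0.
Proof. by move=> m; rewrite msupp0. Qed.

Lemma lowerD W f g : lower W f -> lower W g -> lower W (f + g).
Proof.
by move=> Wf Wg m /msuppD_le; rewrite mem_cat => /orP[/Wf|/Wg].
Qed.

Lemma lowerN W f : lower W f -> lower W (- f).
Proof. by move=> Wf m; rewrite (perm_mem (msuppN f)) => /Wf. Qed.

Lemma lowerX W c m : (wdeg m < W)%N -> lower W (c *: 'X_[m]).
Proof. by move=> mW m' /msuppZ_le; rewrite msuppX inE => /eqP ->. Qed.

Lemma lowerM W W' f g :
  lower W f -> lower W'.+1 g -> lower (W + W') (f * g).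
Proof.
move=> Wf Wg m /msuppM_le/allpairsP[[a b] /= [/Wf Wa /Wg Wb ->]].
by rewrite wdegD; lia.
Qed.

Lemma lower_sum W (T : finType) (P : pred T) (F : T -> S) :
  (forall t, P t -> lower W (F t)) -> lower W (\sum_(t | P t) F t).
Proof. by move=> WF; elim/big_ind: _; [exact: lower0|exact: lowerD|]. Qed.

(** A weight is not a monomial order: m must be the only monomial of maximal weight, while ties
    among the others are harmless. *)
Definition topmon (f : S) (m : 'X_{1..N}) : Prop :=
  exists2 c, c != 0 & exists2 r, lower (wdeg m) r & f = c *: 'X_[m] + r.

Lemma lowerW W W' f : (W <= W')%N -> lower W f -> lower W' f.
Proof. by move=> WW Wf m /Wf; move: WW; lia. Qed.

Lemma topmonM f g m m' : topmon f m -> topmon g m' -> topmon (f * g) (m + m').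
Proof.
move=> [c c0 [r rW ->]] [c' c'0 [r' r'W ->]].
exists (c * c'); first by rewrite mulf_neq0.
exists (r * (c' *: 'X_[m']) + r' * (c *: 'X_[m]) + r * r').
  rewrite wdegD; apply: lowerD; first apply: lowerD.
  - by apply: lowerM => //; apply: lowerX.
  - by rewrite addnC; apply: lowerM => //; apply: lowerX.
  - by apply: lowerM => //; apply: lowerW r'W.
rewrite mpolyXD -!mul_mpolyC mpolyCM; ring.
Qed.

Lemma topmonX c m : c != 0 -> topmon (c *: 'X_[m]) m.
Proof. by move=> c0; exists c => //; exists 0; rewrite ?addr0 //; apply: lower0. Qed.

Lemma topmonXU i : topmon 'X_i U_(i).
Proof. by rewrite -['X_i]scale1r; apply: topmonX; apply: oner_neq0. Qed.

Lemma topmon1 : topmon 1 0.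
Proof. by rewrite -mpolyX0 -['X_[_]]scale1r; apply: topmonX; apply: oner_neq0. Qed.

Lemma topmonN f m : topmon f m -> topmon (- f) m.
Proof.
move=> [c c0 [r rW ->]]; exists (- c); first by rewrite oppr_eq0.
by exists (- r); [apply: lowerN|rewrite opprD scaleNr].
Qed.

Lemma topmonDr f g m : topmon f m -> lower (wdeg m) g -> topmon (f + g) m.
Proof.
move=> [c c0 [r rW ->]] gW; exists c => //; exists (r + g); last by rewrite addrA.
exact: lowerD.
Qed.

Lemma topmon_prod (T : Type) (s : seq T) (P : pred T) (F : T -> S) (M : T -> 'X_{1..N}) :
  (forall t, P t -> topmon (F t) (M t)) ->
  topmon (\prod_(t <- s | P t) F t) (\sum_(t <- s | P t) M t)%MM.
Proof.
move=> FM; elim/big_rec2: _ => [|t f m Pt fm]; first exact: topmon1.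
by apply: topmonM => //; apply: FM.
Qed.

Lemma topmonXn f m n : topmon f m -> topmon (f ^+ n) (m *+ n).
Proof.
move=> fm; elim: n => [|n IH]; first by rewrite expr0 mulm0n; apply: topmon1.
by rewrite exprS mulmS; apply: topmonM.
Qed.

Lemma topmon_coef f m : topmon f m -> f@_m != 0.
Proof.
move=> [c c0 [r rW ->]]; rewrite mcoeffD mcoeffZ mcoeffX eqxx mulr1.
by rewrite memN_msupp_eq0 ?addr0 //; apply/negP => /rW; rewrite ltnn.
Qed.

(** Weights may be 0, so m + q b can have the weight of m; it still differs from m, and every other
    monomial of f weighs less than m. *)
Lemma topmon_uniq f m q (b : 'X_{1..N}) :
  (0 < q)%N -> topmon f m -> b != 0%MM -> f@_(m + b *+ q) = 0.
Proof.
move=> q0 [c c0 [r rW ->]] b0; rewrite mcoeffD mcoeffZ mcoeffX.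
rewrite memN_msupp_eq0 ?addr0; last by apply/negP => /rW; rewrite wdegD; lia.
rewrite -[m in m == _]addm0 eqm_add2l eq_sym -mdeg_eq0 mdegMn muln_eq0 mdeg_eq0.
by rewrite (negPf b0) gtn_eqF // mulr0.
Qed.

End TopMonomials.

(** The criterion in the form used below: multiplication into I^[q] is tested on generators, and the
    condition on F D is read off a leading monomial. *)
Lemma ideal_gen_quot_F_regular (k : fieldType) (N p : nat)
    (charkp : p \in [pchar k]) (A : {mpoly k[N]} -> Prop)
    (J : idealr {mpoly k[N]}) (s : seq ({mpoly k[N]} * {mpoly k[N]} * 'I_N))
    (w : {mpoly k[N]}) (wt : 'I_N -> nat) (e0 : nat) (F : {mpoly k[N]})
    (mu : 'X_{1..N}) :
  (forall f, f \in (J : {pred _}) <-> ideal_gen A f) ->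
  uniq [seq t.2 | t <- s] ->
  pairwise (fun t t' => free_of t'.2 t.1.1) s ->
  (forall t, t \in s -> free_of t.2 (t.1.1 - t.1.2 * 'X_t.2)) ->
  (forall t t', t \in s -> t' \in s -> free_of t'.2 t.1.2) ->
  (forall t, t \in s -> ideal_gen A t.1.1) ->
  (forall t, t \in s -> free_of t.2 w) ->
  (forall e y, A y -> frobenius_power (ideal_gen A) (p ^ e)
     (w * \prod_(t <- s) t.1.1 ^+ (p ^ e).-1 * y)) ->
  (forall y, A y -> frobenius_power (ideal_gen A) (p ^ e0) (F * y)) ->
  (forall i, (mu i < p ^ e0)%N) ->
  topmon wt (F * (w * \prod_(t <- s) t.1.2)) mu ->
  forall v, F_regular v {ideal_quot J}.
Proof.
move=> JE s_uniq s_pw s_rest s_coef s_ideal s_w s_mult F_mult mu_lt top v.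
have idI := ideal_gen_ideal A.
have mult h q y : (forall z, A z -> frobenius_power (ideal_gen A) q (h * z)) ->
    ideal_gen A y -> frobenius_power (ideal_gen A) q (h * y).
  move=> hA [l [lA ->]]; rewrite mulr_sumr; apply: ideal_sum => [|t /lA/hA].
    exact: ideal_gen_ideal.
  rewrite mulrCA.
  by case: (ideal_gen_ideal (fun x => exists2 y, ideal_gen A y & x = y ^+ q)) => _ _; apply.
have proper1 : ~ ideal_gen A 1 by move/JE; rewrite idealr1.
have q0 : (0 < p ^ e0)%N by rewrite expn_gt0 (prime_gt0 (pcharf_prime charkp)).
have FD_mu := topmon_coef top.
have FD_uniq (b : 'X_{1..N}) : b != 0%MM ->
    (F * (w * \prod_(t <- s) t.1.2))@_(mu + b *+ (p ^ e0))%MM = 0.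
  by move=> b0; apply: topmon_uniq top b0.
have e0_gt0 : (0 < e0.+1)%N by [].
have s_mult' e y : ideal_gen A y -> frobenius_power (ideal_gen A) (p ^ e)
     (w * \prod_(t <- s) t.1.1 ^+ (p ^ e).-1 * y).
  by apply: mult => z /s_mult.
have F_mult' y : ideal_gen A y -> frobenius_power (ideal_gen A) (p ^ e0) (F * y).
  exact: mult.
apply: (@ideal_quot_F_regular _ _ p); first by rewrite pchar_lalg.
  move=> x y; rewrite !JE.
  exact: (criterion_prime charkp idI proper1 s_uniq s_pw s_rest s_coef s_ideal
    s_w s_mult' F_mult' mu_lt FD_mu FD_uniq).
move=> f /negP; rewrite JE => nf.
have [e e_gt0 [h [hq hI] hf]] :=
  criterion_split charkp idI s_uniq s_pw s_rest s_coef s_ideal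
    s_w s_mult' F_mult' mu_lt FD_mu FD_uniq nf.
exists e => //; exists h; last exact/JE.
by split=> // y /JE/hI/JE.
Qed.

Lemma frobenius_power_exp (R : comNzRingType) (I : R -> Prop) q x a :
  I x -> frobenius_power I q (a * x ^+ q).
Proof.
move=> Ix; have [_ _] := ideal_gen_ideal (fun x => exists2 y, I y & x = y ^+ q).
by apply; apply: mem_ideal_gen; exists x.
Qed.

(** * The entries of the commutator *)

Section CommutatorEntries.
Variables (k : fieldType) (n : nat).
Local Notation S := {mpoly k[n * n + n * n]}.
Implicit Types i j l : 'I_n.

Definition vx i j : 'I_(n * n + n * n) := lshift (n * n) (mxvec_index i j).
Definition vy i j : 'I_(n * n + n * n) := rshift (n * n) (mxvec_index i j).
Local Notation x i j := ('X_(vx i j) : S).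
Local Notation y i j := ('X_(vy i j) : S).
Local Notation c := (matC k n).

Lemma matCE i j : c i j = \sum_l (x i l * y l j - y i l * x l j).
Proof.
rewrite /matC mxE [X in _ + X]mxE !mxE -sumrB; apply: eq_bigr => l _.
by rewrite !mxE.
Qed.

Lemma mxvec_index_eq i j i' j' :
  (mxvec_index i j == mxvec_index i' j') = (i == i') && (j == j').
Proof.
rewrite /mxvec_index (inj_eq (@cast_ord_inj _ _ _)) (inj_eq enum_rank_inj).
by rewrite xpair_eqE.
Qed.

Lemma vx_eq i j i' j' : (vx i j == vx i' j') = (i == i') && (j == j').
Proof. by rewrite (inj_eq (@lshift_inj _ _)) mxvec_index_eq. Qed.

Lemma vy_eq i j i' j' : (vy i j == vy i' j') = (i == i') && (j == j').
Proof. by rewrite (inj_eq (@rshift_inj _ _)) mxvec_index_eq. Qed.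

Lemma vxy_eq i j i' j' : (vx i j == vy i' j') = false.
Proof.
apply/negbTE/eqP => /(congr1 val) E; have := ltn_ord (mxvec_index i j).
by rewrite -[X in (X < _)%N]/(val (vx i j)) E ltnNge leq_addr.
Qed.

Lemma vyx_eq i j i' j' : (vy i j == vx i' j') = false.
Proof. by rewrite eq_sym vxy_eq. Qed.

Definition vE := (vx_eq, vy_eq, vxy_eq, vyx_eq).

(* The family indexed by the variables with values fx i j at x_ij and fy i j
   at y_ij. *)
Definition matfun (T : Type) (fx fy : 'I_n -> 'I_n -> T) : 'I_(n * n + n * n) -> T :=
  fun z => row_mx (mxvec (\matrix_(i, j) fx i j)) (mxvec (\matrix_(i, j) fy i j)) 0 z.

Lemma matfun_vx T (fx fy : 'I_n -> 'I_n -> T) i j : matfun fx fy (vx i j) = fx i j.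
Proof. by rewrite /matfun row_mxEl mxvecE mxE. Qed.

Lemma matfun_vy T (fx fy : 'I_n -> 'I_n -> T) i j : matfun fx fy (vy i j) = fy i j.
Proof. by rewrite /matfun row_mxEr mxvecE mxE. Qed.

End CommutatorEntries.

Lemma ideal_cE k n f : (f \in (ideal_c k n : {pred _})) <-> ideal_gen (@crossdiag_entry k n) f.
Proof. by split=> /asboolP. Qed.

Lemma ideal_aE k n f : (f \in (ideal_a k n : {pred _})) <-> ideal_gen (@antidiag_entry k n) f.
Proof. by split=> /asboolP. Qed.

(** Nothing is eliminated: the criterion applies with F = D = 1 and q = p^0. *)
Lemma quot_zero_ideal_F_regular (k : fieldType) (N p : nat)
    (charkp : p \in [pchar k]) (A : {mpoly k[N]} -> Prop)
    (J : idealr {mpoly k[N]}) v :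
  (forall f, f \in (J : {pred _}) <-> ideal_gen A f) ->
  (forall f, A f -> f = 0) -> F_regular v {ideal_quot J}.
Proof.
move=> JE A0.
have fp0 q : frobenius_power (ideal_gen A) q 0.
  by have [] := ideal_gen_ideal (fun x => exists2 y, ideal_gen A y & x = y ^+ q).
apply: (@ideal_gen_quot_F_regular k N p charkp A J [::] 1 (fun=> 0%N) 0 1 0) => //.
- by move=> e y /A0 ->; rewrite mulr0.
- by move=> y /A0 ->; rewrite mulr0.
- by move=> i; rewrite mnm0E.
by rewrite big_nil !mulr1; apply: topmon1.
Qed.

Lemma matC_1 (k : fieldType) i j : matC k 1 i j = 0.
Proof.
rewrite matCE big_ord1 !ord1 mulrC subrr //.
Qed.

(** * The cross-diagonal entries for n = 2 *)

Section TwoByTwo.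

(** Two terms suffice, because w will be a multiple of C and w^2 C^(q-2) a multiple of C^q. *)
Lemma expr_sub_mod2 (R : comNzRingType) (u w : R) m :
  exists r, (u - w) ^+ m.+1 = u ^+ m.+1 - m.+1%:R * u ^+ m * w + w ^+ 2 * r.
Proof.
elim: m => [|m [r IH]]; first by exists 0; ring.
exists (m.+1%:R * u ^+ m + r * (u - w)).
rewrite exprSr IH [in RHS]exprS -[in m.+2%:R]addn1 natrD exprS.
by move: m.+1%:R (u ^+ m) => a b; ring.
Qed.

(* If [a A = x1 B - x2 C] and [b A = y1 B - y2 C] then, up to a power of C, the
   claim is the expansion of [(b A)^(q-1) (a A)] modulo [B^q] and [C^q]. *)
Lemma minors_frobenius (R : comNzRingType) (p e : nat) (charRp : p \in [pchar R])
    (K : R -> Prop) (A B C a b x1 x2 y1 y2 : R) :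
  (0 < e)%N -> ideal K -> K (A ^+ (p ^ e)) -> K (B ^+ (p ^ e)) -> K (C ^+ (p ^ e)) ->
  a * A = x1 * B - x2 * C -> b * A = y1 * B - y2 * C -> A = x1 * y2 - x2 * y1 ->
  K (y1 ^+ (p ^ e).-2 * (B * C) ^+ (p ^ e).-1 * A).
Proof.
move=> e0 idK; set q := (p ^ e)%N => KA KB KC aA bA AE.
have p_gt1 := prime_gt1 (pcharf_prime charRp).
have [m qE] : exists m, q = m.+2.
  exists q.-2; have : (p ^ 1 <= q)%N by rewrite leq_exp2l.
  by rewrite expn1; lia.
(* Here m + 1 = q - 1. This sign makes the two terms in (B C)^(q-1) combine into x1 y2 - x2 y1 =
   A. *)
have mE : (m.+1%:R : R) = -1.
  apply/eqP; rewrite -subr_eq0 opprK natr1 -qE natrX (pcharf0 charRp) expr0n.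
  by rewrite gtn_eqF.
have [r rE] := expr_sub_mod2 (y1 * B) (y2 * C) m.
have : K (b ^+ m.+1 * a * C ^+ m * A ^+ q) by case: idK => _ _; apply.
have -> : b ^+ m.+1 * a * C ^+ m * A ^+ q = (b * A) ^+ m.+1 * (a * A) * C ^+ m.
  by rewrite qE exprMn [A ^+ m.+2]exprSr; ring.
rewrite bA aA rE mE => KH.
have -> : y1 ^+ q.-2 * (B * C) ^+ q.-1 * A =
  (((y1 * B) ^+ m.+1 - -1 * (y1 * B) ^+ m * (y2 * C) + (y2 * C) ^+ 2 * r)
     * (x1 * B - x2 * C) * C ^+ m)
  - (y1 ^+ m.+1 * x1 * C ^+ m) * B ^+ q
  - (y2 ^+ 2 * r * (x1 * B - x2 * C) - y1 ^+ m * y2 * x2 * B ^+ m) * C ^+ q.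
  rewrite AE qE /= !exprMn !(exprS _ m.+1) !(exprS _ m) expr2.
  by move: (y1 ^+ m) (B ^+ m) (C ^+ m) => u v t; ring.
by case: (idK) => _ _ IM; do 2?apply: idealB => //; apply: IM.
Qed.
End TwoByTwo.

Lemma lowerXX (k : fieldType) (N : nat) (wt : 'I_N -> nat) W i j :
  (wt i + wt j < W)%N -> lower wt W ('X_i * 'X_j : {mpoly k[N]}).
Proof.
by move=> ijW; rewrite -mpolyXD -['X_[_]]scale1r; apply: lowerX; rewrite wdegD !wdegU.
Qed.

Ltac prove_free := repeat first
  [ apply: freeD | apply: freeN | apply: freeM | apply: free1
  | apply: freeXU; rewrite !vE //= ].

Section TwoByTwoCrossDiagonal.
Variables (k : fieldType) (p : nat) (charkp : p \in [pchar k]).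
Local Notation S := {mpoly k[2 * 2 + 2 * 2]}.
Local Notation o := (ord0 : 'I_2).
Local Notation u := (ord_max : 'I_2).
Local Notation x i j := ('X_(@vx 2 i j) : S).
Local Notation y i j := ('X_(@vy 2 i j) : S).
Local Notation c := (matC k 2).

Lemma matC_2 i j : c i j = x i o * y o j + x i u * y u j - y i o * x o j - y i u * x u j.
Proof.
rewrite matCE !big_ord_recl big_ord0 addr0.
have -> : lift o ord0 = u by apply: val_inj.
ring.
Qed.

(** With rows and columns numbered from 0, x_00 y_01 leads c_01 and x_10 y_00 leads c_10. *)
Definition weight_2 : 'I_(2 * 2 + 2 * 2) -> nat :=
  matfun (fun _ j => nat_of_bool (j == o)) (fun i _ => nat_of_bool (i == o)).

(** The entry c_00 is solved for y_10 and c_01 for y_00, with coefficients x_01 and -x_01; F is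
    y_10^(q-2) (c_01 c_10)^(q-1). *)
Lemma ideal_c_2_F_regular v : F_regular v {ideal_quot (ideal_c k 2)}.
Proof.
have c01A : crossdiag_entry (c o u).
  by right; exists o; congr (c _ _); apply: val_inj.
have c10A : crossdiag_entry (c u o).
  by right; exists u; congr (c _ _); apply: val_inj.
have c00A : crossdiag_entry (c o o) by left; exists o.
pose I := ideal_gen (@crossdiag_entry k 2).
have c01I : I (c o u) by apply: mem_ideal_gen.
have c10I : I (c u o) by apply: mem_ideal_gen.
have c00I : I (c o o) by apply: mem_ideal_gen.
have entry f : crossdiag_entry f -> [\/ f = c o o, f = - c o o, f = c o u | f = c u o].
  case=> -[i ->]; have [->|->] : i = o \/ i = u.
  - by case: i => [[|[|//]] ?]; [left|right]; apply: val_inj.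
  - by constructor 1.
  - by constructor 2; rewrite !matC_2; ring.
  - by case: i => [[|[|//]] ?]; [left|right]; apply: val_inj.
  - by constructor 3; congr (c _ _); apply: val_inj.
  - by constructor 4; congr (c _ _); apply: val_inj.
pose s := [:: (c o o, x o u, @vy 2 u o); (c o u, - x o u, @vy 2 o o)].
(* With w = x_01 the product D is -x_01^3, so q must exceed 3. *)
set q := (p ^ 2)%N.
have q_ge4 : (4 <= q)%N.
  by rewrite (@leq_exp2r 2 p 2) // prime_gt1 // (pcharf_prime charkp).
pose mu : 'X_{1..2 * 2 + 2 * 2} := (U_(@vy 2 u o) *+ q.-2
  + ((U_(@vx 2 o o) + U_(@vy 2 o u)) + (U_(@vx 2 u o) + U_(@vy 2 o o))) *+ q.-1
  + (U_(@vx 2 o u) + (U_(@vx 2 o u) + (U_(@vx 2 o u) + 0))))%MM.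
have fp q' := ideal_gen_ideal (fun x => exists2 y, I y & x = y ^+ q').
apply: (@ideal_gen_quot_F_regular k _ p charkp _ _ s (x o u) weight_2 2
  (y u o ^+ q.-2 * (c o u * c u o) ^+ q.-1) mu (@ideal_cE k 2)).
- by rewrite /= !inE !vE.
- rewrite /= !andbT.
  have -> : c o o = x o u * y u o - y o u * x u o by rewrite matC_2; ring.
  by prove_free.
- move=> t; rewrite !inE => /orP[]/eqP-> /=.
    have -> : c o o - x o u * y u o = - (y o u * x u o) by rewrite matC_2; ring.
    by prove_free.
  have -> : c o u - - x o u * y o o = x o o * y o u + x o u * y u u - y o u * x u u.
    by rewrite matC_2; ring.
  by prove_free.
- move=> t t'; rewrite !inE => /orP[]/eqP-> /orP[]/eqP-> /=; prove_free.
- by move=> t; rewrite !inE => /orP[]/eqP->.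
- by move=> t; rewrite !inE => /orP[]/eqP-> /=; prove_free.
- move=> e f /entry fE; rewrite /s !big_cons big_nil /=; set q' := (p ^ e)%N.
  have q'E : q' = q'.-1.+1.
    by rewrite prednK // expn_gt0 prime_gt0 // (pcharf_prime charkp).
  set m := q'.-1 in q'E *.
  have m1 a : I (c o o) -> frobenius_power I q' (a * c o o ^+ m.+1).
    by rewrite -q'E; apply: frobenius_power_exp.
  have m2 a : I (c o u) -> frobenius_power I q' (a * c o u ^+ m.+1).
    by rewrite -q'E; apply: frobenius_power_exp.
  have w00 : frobenius_power I q' (x o u * (c o o ^+ m * (c o u ^+ m * 1)) * c o o).
    have -> : x o u * (c o o ^+ m * (c o u ^+ m * 1)) * c o o =
      x o u * c o u ^+ m * c o o ^+ m.+1 by rewrite exprS; ring.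
    exact: m1.
  case: fE => ->.
  + exact: w00.
  + by rewrite mulrN; apply: (idealN (fp q') w00).
  + have -> : x o u * (c o o ^+ m * (c o u ^+ m * 1)) * c o u =
      x o u * c o o ^+ m * c o u ^+ m.+1 by rewrite exprS; ring.
    exact: m2.
  (* This relation is the reason for w = x_01: it puts x_01 c_10 into the ideal of the two
     pivots. *)
  have E : x o u * c u o = - (x o o - x u u) * c o o - x u o * c o u.
    by rewrite !matC_2; ring.
  have -> : x o u * (c o o ^+ m * (c o u ^+ m * 1)) * c u o =
      (- (x o o - x u u) * c o u ^+ m) * c o o ^+ m.+1 -
      (x u o * c o o ^+ m) * c o u ^+ m.+1.
    transitivity (c o o ^+ m * c o u ^+ m * (x o u * c u o)); first by ring.
    by rewrite E !exprS; ring.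
  by apply: (idealB (fp q')); [apply: m1|apply: m2].
- move=> f /entry fE.
  have qS (z : S) : z ^+ q = z * z ^+ q.-1 by rewrite -exprS; congr (_ ^+ _); lia.
  have minor : frobenius_power I q (y u o ^+ q.-2 * (c o u * c u o) ^+ q.-1 * c o o).
    (* The minors with consistent signs are -c_00, c_01 and -c_10; (-1)^q corrects the product. *)
    have -> : y u o ^+ q.-2 * (c o u * c u o) ^+ q.-1 * c o o =
       (- 1) ^+ q * (y u o ^+ q.-2 * (c o u * - c u o) ^+ q.-1 * - c o o).
      rewrite qS !exprMn [(- c u o) ^+ _]exprNn.
      have := signrMK q.-1 (1 : S); rewrite mulr1 => E.
      transitivity ((-1) ^+ q.-1 * (-1) ^+ q.-1 *
        (y u o ^+ q.-2 * (c o u ^+ q.-1 * c u o ^+ q.-1) * c o o)).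
        by rewrite E mul1r.
      ring.
    case: (fp q) => _ _; apply.
    have charSp : p \in [pchar S] by rewrite pchar_lalg.
    have fpx z : I z -> frobenius_power I q (z ^+ q).
      by move=> Iz; rewrite -[_ ^+ q]mul1r; apply: frobenius_power_exp.
    have IN z : I z -> I (- z) by apply: idealN; apply: ideal_gen_ideal.
    apply: (minors_frobenius charSp (K := frobenius_power I q) (a := x o o - x u u)
      (b := y o o - y u u) (x1 := x u o) (x2 := x o u) (y2 := y o u)) => //;
      [exact: fp|exact/fpx/IN|exact/fpx|exact/fpx/IN|..];
      by rewrite !matC_2; ring.
  case: fE => ->.
  + exact: minor.
  + by rewrite mulrN; apply: (idealN (fp q) minor).
  + have -> : y u o ^+ q.-2 * (c o u * c u o) ^+ q.-1 * c o u =
      (y u o ^+ q.-2 * c u o ^+ q.-1) * c o u ^+ q.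
      by rewrite qS exprMn; ring.
    exact: frobenius_power_exp.
  + have -> : y u o ^+ q.-2 * (c o u * c u o) ^+ q.-1 * c u o =
      (y u o ^+ q.-2 * c o u ^+ q.-1) * c u o ^+ q.
      by rewrite qS exprMn; ring.
    exact: frobenius_power_exp.
- move=> z; rewrite /mu !(mnmDE, mulmnE, mnm1E, mnm0E) -/q.
  have [<-|_] := eqVneq (@vy 2 u o) z; first by rewrite !vE /=; lia.
  have [<-|_] := eqVneq (@vx 2 o o) z; first by rewrite !vE /=; lia.
  have [<-|_] := eqVneq (@vy 2 o u) z; first by rewrite !vE /=; lia.
  have [<-|_] := eqVneq (@vx 2 u o) z; first by rewrite !vE /=; lia.
  have [<-|_] := eqVneq (@vy 2 o o) z; first by rewrite !vE /=; lia.
  by case: (@vx 2 o u == z) => /=; lia.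
rewrite /s !big_cons big_nil /=.
apply: topmonM; first (apply: topmonM; [|apply: topmonXn; apply: topmonM]).
- exact/topmonXn/topmonXU.
- have -> : c o u = x o o * y o u + (x o u * y u u + - (y o o * x o u) + - (y o u * x u u)).
    by rewrite matC_2; ring.
  apply: topmonDr; first by apply: topmonM; apply: topmonXU.
  rewrite wdegD !wdegU; do 2?apply: lowerD; do ?apply: lowerN;
    by apply: lowerXX; rewrite /weight_2 !(matfun_vx, matfun_vy).
- have -> : c u o = x u o * y o o + (x u u * y u o + - (y u o * x o o) + - (y u u * x u o)).
    by rewrite matC_2; ring.
  apply: topmonDr; first by apply: topmonM; apply: topmonXU.
  rewrite wdegD !wdegU; do 2?apply: lowerD; do ?apply: lowerN;
    by apply: lowerXX; rewrite /weight_2 !(matfun_vx, matfun_vy).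
apply: topmonM; first exact: topmonXU.
apply: topmonM; first exact: topmonXU.
by apply: topmonM; [apply/topmonN/topmonXU|apply: topmon1].
Qed.

End TwoByTwoCrossDiagonal.

(** * The case n >= 3 *)

(** Every term of the expansion has total degree 2 q - 1 in f and g, so one of them occurs to a
    power at least q. *)
Lemma pair_frobenius (R : comNzRingType) (K : R -> Prop) (q : nat) (a b a' b' f g : R) :
  (0 < q)%N -> ideal K -> K (f ^+ q) -> K (g ^+ q) ->
  K ((a * f + b * g) ^+ q.-1 * (a' * f + b' * g) ^+ q.-1 * f).
Proof.
move=> q0 idK Kf Kg; have [_ _ KM] := idK.
rewrite !exprDn !mulr_suml; apply: ideal_sum => // i _.
rewrite mulr_sumr mulr_suml; apply: ideal_sum => // j _.
rewrite -[X in X * _ * _]mulr_natr -[X in _ * X * _]mulr_natr !exprMn.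
have [qij|ijq] := leqP q (i + j).
  have [m mE] : exists m, (i + j = m + q)%N by exists (i + j - q)%N; rewrite subnK.
  rewrite [X in K X](_ : _ = a ^+ (q.-1 - i) * f ^+ (q.-1 - i) * b ^+ i * 'C(q.-1, i)%:R
    * a' ^+ (q.-1 - j) * f ^+ (q.-1 - j) * b' ^+ j * 'C(q.-1, j)%:R * f * g ^+ m * g ^+ q).
    exact: KM.
  rewrite -[RHS]mulrA -exprD -mE exprD.
  move: (a ^+ _) (a' ^+ _) (b ^+ _) (b' ^+ _) (f ^+ (_ - i)) (f ^+ (_ - j)) => a1 a2 b1 b2 f1 f2.
  move: (g ^+ i) (g ^+ j) ('C(_, i)%:R) ('C(_, j)%:R) => g1 g2 c1 c2; ring.
have [m mE] : exists m, ((q.-1 - i) + (q.-1 - j) + 1 = m + q)%N.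
  exists ((q.-1 - i) + (q.-1 - j) + 1 - q)%N; rewrite subnK //.
  by have := ltn_ord i; have := ltn_ord j; lia.
rewrite [X in K X](_ : _ = a ^+ (q.-1 - i) * b ^+ i * g ^+ i * 'C(q.-1, i)%:R
    * a' ^+ (q.-1 - j) * b' ^+ j * g ^+ j * 'C(q.-1, j)%:R * f ^+ m * f ^+ q).
  exact: KM.
rewrite -[RHS]mulrA -exprD -mE !exprD expr1.
move: (a ^+ _) (a' ^+ _) (b ^+ _) (b' ^+ _) (f ^+ (_ - i)) (f ^+ (_ - j)) => a1 a2 b1 b2 f1 f2.
move: (g ^+ i) (g ^+ j) ('C(_, i)%:R) ('C(_, j)%:R) => g1 g2 c1 c2; ring.
Qed.

Section EntrySupports.
Variables (k : fieldType) (n : nat).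
Local Notation S := {mpoly k[n * n + n * n]}.
Implicit Types i j l : 'I_n.
Local Notation x i j := ('X_(vx i j) : S).
Local Notation y i j := ('X_(vy i j) : S).
Local Notation c := (matC k n).

Lemma matC_trace : \sum_i c i i = 0.
Proof.
under eq_bigr do rewrite matCE sumrB.
rewrite sumrB; apply/eqP; rewrite subr_eq0; apply/eqP.
rewrite exchange_big; apply: eq_bigr => i _; apply: eq_bigr => j _.
exact: mulrC.
Qed.

Lemma free_matC_x a b i j : a != i -> b != j -> free_of (vx a b) (c i j).
Proof.
move=> ai bj; rewrite matCE; apply: free_sum => l _.
by prove_free; rewrite negb_and eq_sym ?ai ?[j == b]eq_sym ?bj ?orbT.
Qed.

Lemma free_matC_y a b i j : a != i -> b != j -> free_of (vy a b) (c i j).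
Proof.
move=> ai bj; rewrite matCE; apply: free_sum => l _.
by prove_free; rewrite negb_and eq_sym ?ai ?[j == b]eq_sym ?bj ?orbT.
Qed.

(** The only candidate summand x_ii y_ii - y_ii x_ii of c_ii vanishes. *)
Lemma free_matC_diag_x a i : free_of (vx a a) (c i i).
Proof.
rewrite matCE; apply: free_sum => l _; have [->|li] := eqVneq l i.
  by rewrite mulrC subrr free0.
by prove_free; apply: contra li => /andP[/eqP-> /eqP->].
Qed.

Lemma free_matC_diag_y a i : free_of (vy a a) (c i i).
Proof.
rewrite matCE; apply: free_sum => l _; have [->|li] := eqVneq l i.
  by rewrite mulrC subrr free0.
by prove_free; apply: contra li => /andP[/eqP-> /eqP->].
Qed.

Lemma matC_diag_rest i l : l != i -> exists2 r, c i i = x i l * y l i - y i l * x l i + r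
  & free_of (vx i l) r /\ free_of (vy i l) r.
Proof.
move=> li; rewrite matCE (bigD1 l) //=; eexists; first by [].
split; apply: free_sum => l' l'l; (have [->|l'i] := eqVneq l' i;
  first by rewrite mulrC subrr free0); prove_free; rewrite ?negb_and ?l'l ?orbT ?l'i //.
Qed.

End EntrySupports.

(* For n = N + 1, with rows and columns numbered from 0 and i' = N - i, these
   weights were found by solving the inequalities which say that the following
   monomials are leading:
     x_ii y_i'i          in c_i'i for i < i',
     x_i0 y_0i'          in c_ii' for 0 < i < i',   y_01 x_1N  in c_0N,
     y_i0 x_0i           in c_ii  for 0 < i < N,    x_N1 y_1N  in c_NN,
     x_i'i y_ii'         in the minor x_i'i y_ii' - x_ii' y_i'i for i < i'. *)
Definition weight_x (N i j : nat) : nat :=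
  if (i == j) && (2 * i < N)%N then 8
  else if (i + j == N)%N && (j < i)%N then 2
  else if (i == 0%N) && (0 < j < N)%N then 8
  else if (j == 0%N) && (0 < i)%N && (2 * i < N)%N then 2
  else if (i == 1%N) && (j == N) then 5
  else if (i == N) && (j == 1%N) then 6
  else 0.

Definition weight_y (N i j : nat) : nat :=
  if (i + j == N)%N && (j < i)%N then 1
  else if (i == 0%N) && (N < 2 * j)%N && (j < N)%N then 7
  else if (i == 0%N) && (j == 1%N) then 5
  else 0.

(* The variable is sent to the position of the entry of C whose leading monomial
   involves it, and to (N + 1, N + 1) if there is none. *)
Definition owner_x (N i j : nat) : nat * nat :=
  if (i == j) && (2 * i < N)%N then ((N - i)%N, i)
  else if (i == 0%N) && (0 < j < N)%N then (j, j)
  else if (j == 0%N) && (0 < i)%N && (2 * i < N)%N then (i, (N - i)%N)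
  else if (i == 1%N) && (j == N) then (0%N, N)
  else if (i == N) && (j == 1%N) then (N, N)
  else (N.+1, N.+1).

Definition owner_y (N i j : nat) : nat * nat :=
  if (i + j == N)%N && (j < i)%N then (i, j)
  else if (i == 0%N) && (N < 2 * j)%N && (j < N)%N then ((N - j)%N, j)
  else if (i == 0%N) && (j == 1%N) then (0%N, N)
  else if (j == 0%N) && (0 < i < N)%N then (i, i)
  else if (i == 1%N) && (j == N) then (N, N)
  else (N.+1, N.+1).

Ltac split_ifs :=
  repeat (case: ifP => ?; try (exfalso; lia)); first [done | congr pair; lia | lia].

Lemma pairwise_map_uniq (T : eqType) (U : Type) (f : T -> U) (r : rel U) (s : seq T) :
  uniq s -> (forall i j, i \in s -> j \in s -> i != j -> r (f i) (f j)) ->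
  pairwise r [seq f i | i <- s].
Proof.
move=> us rf; rewrite pairwise_map; move: us; rewrite uniq_pairwise.
by apply: (@sub_in_pairwise _ (mem s)) => [i j is_ js|]; [apply: rf|apply/allP].
Qed.

Lemma sum_eq_le1 (T T' : eqType) (s : seq T) (f : T -> T') z :
  uniq s -> injective f -> (\sum_(i <- s) (f i == z) <= 1)%N.
Proof.
move=> us finj; rewrite -(big_map f xpredT (fun w => nat_of_bool (w == z))).
rewrite (_ : \sum_(w <- _) _ = count_mem z [seq f i | i <- s]).
  by rewrite count_uniq_mem ?map_inj_uniq // leq_b1.
by rewrite -sum1_count [RHS]big_mkcond; apply: eq_bigr => w _ /=; case: (w == z).
Qed.

(** * Leading monomials of the entries for n = N + 1 >= 3 *)

Section LargeMatrices.
Variables (k : fieldType) (N : nat).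
Hypothesis N_ge2 : (2 <= N)%N.
Local Notation n := N.+1.
Local Notation S := {mpoly k[n * n + n * n]}.
Implicit Types i j l : 'I_n.
Local Notation x i j := ('X_(@vx n i j) : S).
Local Notation y i j := ('X_(@vy n i j) : S).
Local Notation c := (matC k n).
Local Notation rv := (@rev_ord n).
Local Notation o1 := (inord 1 : 'I_n).
Local Notation oN := (ord_max : 'I_n).
Local Notation oM := (inord N.-1 : 'I_n).

Let val_rev i : val (rv i) = (N - i)%N.
Proof. by rewrite /= subSS. Qed.

Let val_o1 : val o1 = 1%N.
Proof. by rewrite /= inordK //; lia. Qed.

Let val_oM : val oM = N.-1.
Proof. by rewrite /= inordK //; lia. Qed.

Definition wt := @matfun n nat (weight_x N) (weight_y N).
Definition owner := @matfun n (nat * nat) (owner_x N) (owner_y N).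

Lemma wtE : (forall i j, wt (vx i j) = weight_x N i j) *
            (forall i j, wt (vy i j) = weight_y N i j).
Proof. by split=> i j; rewrite /wt (matfun_vx, matfun_vy). Qed.

Lemma ownerE : (forall i j, owner (vx i j) = owner_x N i j) *
               (forall i j, owner (vy i j) = owner_y N i j).
Proof. by split=> i j; rewrite /owner (matfun_vx, matfun_vy). Qed.

Lemma lower_matC_terms W i j l :
  (weight_x N i l + weight_y N l j < W)%N ->
  (weight_y N i l + weight_x N l j < W)%N ->
  lower wt W (x i l * y l j - y i l * x l j).
Proof.
by move=> h1 h2; apply: lowerD; last apply: lowerN; apply: lowerXX;
  rewrite !wtE.
Qed.

(** For i = j the summand with index i vanishes, so its monomials are exempt from the comparison. *)
Lemma topmon_matC_xy i j l : ~~ ((l == i) && (i == j)) ->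
  (forall l', l' != l -> ~~ ((l' == i) && (i == j)) ->
     (weight_x N i l' + weight_y N l' j < weight_x N i l + weight_y N l j)%N) ->
  (forall l', ~~ ((l' == i) && (i == j)) ->
     (weight_y N i l' + weight_x N l' j < weight_x N i l + weight_y N l j)%N) ->
  topmon wt (c i j) (U_(vx i l) + U_(vy l j)).
Proof.
move=> lij xy yx; rewrite matCE (bigD1 l) //= -addrA; apply: topmonDr.
  by apply: topmonM; apply: topmonXU.
rewrite wdegD !wdegU !wtE; apply: lowerD.
  by apply/lowerN/lowerXX; rewrite !wtE; apply: yx.
apply: lower_sum => l' l'l; have [/andP[/eqP-> /eqP<-]|h] := boolP ((l' == i) && (i == j)).
  by rewrite mulrC subrr; apply: lower0.
by apply: lower_matC_terms => //; [apply: xy|apply: yx].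
Qed.

Lemma topmon_matC_yx i j l : ~~ ((l == i) && (i == j)) ->
  (forall l', l' != l -> ~~ ((l' == i) && (i == j)) ->
     (weight_y N i l' + weight_x N l' j < weight_y N i l + weight_x N l j)%N) ->
  (forall l', ~~ ((l' == i) && (i == j)) ->
     (weight_x N i l' + weight_y N l' j < weight_y N i l + weight_x N l j)%N) ->
  topmon wt (c i j) (U_(vy i l) + U_(vx l j)).
Proof.
move=> lij yx xy; rewrite matCE (bigD1 l) //= addrAC addrC; apply: topmonDr.
  by apply/topmonN/topmonM; apply: topmonXU.
rewrite wdegD !wdegU !wtE; apply: lowerD.
  by apply: lowerXX; rewrite !wtE; apply: xy.
apply: lower_sum => l' l'l; have [/andP[/eqP-> /eqP<-]|h] := boolP ((l' == i) && (i == j)).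
  by rewrite mulrC subrr; apply: lower0.
by apply: lower_matC_terms => //; [apply: xy|apply: yx].
Qed.

(** The monomials tabulated with the weights. For even N the central entry, both diagonal and
    anti-diagonal, is treated as diagonal. *)
Definition lead_vars (t : 'I_n * 'I_n) : 'I_(n * n + n * n) * 'I_(n * n + n * n) :=
  let: (i, j) := t in
  if i == j then
    if i == oN then (vx oN o1, vy o1 oN) else (vy i ord0, vx ord0 i)
  else if (j < i)%N then (vx j j, vy i j)
  else if i == ord0 then (vy ord0 o1, vx o1 oN)
  else (vx i ord0, vy ord0 j).

(* True for the cross-diagonal entries, false for the anti-diagonal ones. *)
Variable b : bool.
(* As C has trace 0, the entry c_00 is redundant among the diagonal ones. *)
Definition entry_set (t : 'I_n * 'I_n) :=
  (t.2 == rv t.1) || [&& b, t.1 == t.2 & t.1 != ord0].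

Definition lead_mnm t : 'X_{1..n * n + n * n} :=
  (U_((lead_vars t).1) + U_((lead_vars t).2))%MM.

Lemma topmon_entry t : entry_set t -> topmon wt (c t.1 t.2) (lead_mnm t).
Proof.
case: t => i j; rewrite /entry_set /lead_mnm /lead_vars /=.
have iN := ltn_ord i; have jN := ltn_ord j.
case: (eqVneq i j) => [<-{j jN}|ij] ijP.
  have i0 : (0 < i)%N by move: ijP; rewrite -!val_eqE /= subSS; lia.
  case: (eqVneq i oN) => [->|].
    have wx_top : weight_x N N 1 = 6%N by rewrite /weight_x; split_ifs.
    have wy_top : weight_y N 1 N = 0%N by rewrite /weight_y; split_ifs.
    apply: topmon_matC_xy; first (by rewrite -!val_eqE /= val_o1; lia);
      move=> l; have := ltn_ord l; rewrite -!val_eqE /= val_o1 wx_top wy_top;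
      move: (nat_of_ord l) => {wx_top wy_top ijP i0 i iN} l;
      by rewrite /weight_x /weight_y => *; split_ifs.
  rewrite -val_eqE /=; move: ijP i0 => _ i0 iN'.
  have wx_top : weight_x N 0 i = 8%N by rewrite /weight_x; split_ifs.
  have wy_top : weight_y N i 0 = 0%N by rewrite /weight_y; split_ifs.
  apply: topmon_matC_yx; first (by rewrite -!val_eqE /=; lia);
    move=> l; have := ltn_ord l; rewrite -!val_eqE /= wx_top wy_top;
    move: (nat_of_ord l) => {wx_top wy_top} l; move: (nat_of_ord i) i0 iN iN' => {}i *;
    by rewrite /weight_x /weight_y; split_ifs.
have jE : (j : nat) = (N - i)%N.
  by move: ijP; rewrite andbF orbF => /eqP ->; rewrite /= subSS.
move: ij ijP; rewrite -val_eqE /= => ij _.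
case: ifP => ji.
  rewrite addmC.
  have wx_top : weight_x N j j = 8%N by rewrite /weight_x; split_ifs.
  have wy_top : weight_y N i j = 1%N by rewrite /weight_y; split_ifs.
  apply: topmon_matC_yx; first (by rewrite -!val_eqE /=; lia);
    move=> l; have := ltn_ord l; rewrite -!val_eqE /= wx_top wy_top;
    move: (nat_of_ord l) => {wx_top wy_top} l;
    move: (nat_of_ord i) (nat_of_ord j) iN jN jE ij ji => {i j} i j *;
    by rewrite /weight_x /weight_y; split_ifs.
case: (eqVneq i ord0) => [i0|].
  have -> : j = oN by apply: val_inj; rewrite /= jE i0 /=; lia.
  rewrite i0.
  have wx_top : weight_x N 1 N = 5%N by rewrite /weight_x; split_ifs.
  have wy_top : weight_y N 0 1 = 5%N by rewrite /weight_y; split_ifs.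
  apply: topmon_matC_yx; first (by rewrite -!val_eqE /= ; lia);
    move=> l; have := ltn_ord l; rewrite -!val_eqE /= val_o1 wx_top wy_top;
    move: (nat_of_ord l) => {wx_top wy_top ij ji jE iN jN i0 i j} l *;
    by rewrite /weight_x /weight_y; split_ifs.
rewrite -val_eqE /= => i0.
have wx_top : weight_x N i 0 = 2%N by rewrite /weight_x; split_ifs.
have wy_top : weight_y N 0 j = 7%N by rewrite /weight_y; split_ifs.
apply: topmon_matC_xy; first (by rewrite -!val_eqE /=; lia);
  move=> l; have := ltn_ord l; rewrite -!val_eqE /= wx_top wy_top;
  move: (nat_of_ord l) => {wx_top wy_top} l;
  move: (nat_of_ord i) (nat_of_ord j) iN jN jE ij ji i0 => {i j} i j *;
  by rewrite /weight_x /weight_y; split_ifs.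
Qed.

(** Since each variable has a single owner, this makes the leading monomials squarefree and pairwise
    coprime. *)
Lemma lead_mnm_owner t z : entry_set t ->
  (lead_mnm t z <= (owner z == (val t.1, val t.2)))%N.
Proof.
case: t => i j; rewrite /entry_set /lead_mnm mnmDE !mnm1E /= => ijP.
have iN := ltn_ord i; have jN := ltn_ord j.
have jE : i != j -> (j : nat) = (N - i)%N.
  by move: ijP => + /negPf ij; rewrite ij andbF orbF => /eqP ->; rewrite /= subSS.
have i0 : i = j -> (0 < i)%N.
  by move=> ij; move: ijP; rewrite -ij -!val_eqE /= subSS; lia.
suff [E1 E2 E3] : [/\ (lead_vars (i, j)).1 != (lead_vars (i, j)).2,
    owner (lead_vars (i, j)).1 = (val i, val j) &
    owner (lead_vars (i, j)).2 = (val i, val j)].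
  have [z1|z1] := eqVneq (lead_vars (i, j)).1 z.
    by rewrite -z1 E2 eqxx eq_sym (negPf E1).
  by have [<-|z2] := eqVneq (lead_vars (i, j)).2 z; rewrite ?E3 ?eqxx.
rewrite /lead_vars; case: (eqVneq i j) => [ij|/[dup] ij /jE {}jE].
  have {}i0 := i0 ij; rewrite -{}ij in jE *.
  have [iE|] := eqVneq i oN; first rewrite iE.
    by rewrite !vE !ownerE /= val_o1 /owner_x /owner_y; split=> //; split_ifs.
  rewrite -val_eqE /= => iN'; rewrite !vE !ownerE /= /owner_x /owner_y.
  by split=> //; split_ifs.
move: ij; rewrite -val_eqE /= => ij {ijP i0}; case: ifP => ji.
  rewrite !vE !ownerE /= /owner_x /owner_y.
  by split=> //; split_ifs.
have [i0|] := eqVneq i ord0; last rewrite -val_eqE /= => i0.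
  rewrite !vE !ownerE /= val_o1 jE i0 /= /owner_x /owner_y.
  by split=> //; split_ifs.
rewrite !vE !ownerE /= /owner_x /owner_y.
by split=> //; split_ifs.
Qed.

Lemma sum_lead_mnm_le1 z : (\sum_(t : 'I_n * 'I_n | entry_set t) lead_mnm t z <= 1)%N.
Proof.
apply: (@leq_trans (\sum_(t : 'I_n * 'I_n) (owner z == (val t.1, val t.2)))).
  rewrite [X in (X <= _)%N]big_mkcond; apply: leq_sum => t _.
  by case: ifP => // /lead_mnm_owner.
have [/existsP[t0 /eqP ->]|/existsPn nz] :=
  boolP [exists t : 'I_n * 'I_n, owner z == (val t.1, val t.2)]; last first.
  by rewrite big1 // => t _; rewrite (negPf (nz t)).
rewrite (bigD1 t0) //= eqxx big1 // => t tt0.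
by rewrite eq_sym xpair_eqE !val_eqE -xpair_eqE -!surjective_pairing (negPf tt0).
Qed.

Lemma sum_lead_mnm_eq0 z : owner z = (N.+1, N.+1) ->
  (\sum_(t : 'I_n * 'I_n | entry_set t) lead_mnm t z = 0)%N.
Proof.
move=> zN; apply: big1 => t /(lead_mnm_owner z); rewrite zN xpair_eqE.
by rewrite gtn_eqF //= leqn0 => /eqP.
Qed.

(** * The eliminated variables for n >= 3 *)

Definition pivot_diag := [seq i : 'I_n <- enum 'I_n | (0 < i < N)%N && (b || (2 * i == N)%N)].
Definition pairs := [seq i : 'I_n <- enum 'I_n | (2 * i < N)%N].

(** The determinant of c_ii' and c_i'i as linear forms in x_ii and y_ii. *)
Definition minor i : S := x (rv i) i * y i (rv i) - x i (rv i) * y (rv i) i.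
(* In the pair c_ii', c_i'i the variables x_ii and y_ii occur linearly, so
   Cramer's rule separates them. *)
Definition elim_x i : S := x (rv i) i * c i (rv i) + x i (rv i) * c (rv i) i.
Definition elim_y i : S := y (rv i) i * c i (rv i) + y i (rv i) * c (rv i) i.

(* Triples (g, d, z) with g = d z + r. *)
Definition pivots : seq (S * S * 'I_(n * n + n * n)) :=
  (if b then [:: (c ord0 ord0, - x oM ord0, @vy n ord0 oM)] else [::]) ++
  [seq (c i i, y oN i, vx i oN) | i <- pivot_diag] ++
  [seq (elim_x i, minor i, vx i i) | i <- pairs] ++
  [seq (elim_y i, minor i, vy i i) | i <- pairs].

Lemma mem_pivots t : t \in pivots ->
  [\/ b /\ t = (c ord0 ord0, - x oM ord0, @vy n ord0 oM),
     exists2 i, i \in pivot_diag & t = (c i i, y oN i, vx i oN),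
     exists2 i, i \in pairs & t = (elim_x i, minor i, vx i i) |
     exists2 i, i \in pairs & t = (elim_y i, minor i, vy i i)].
Proof.
rewrite /pivots !mem_cat => /or4P[|/mapP[i]|/mapP[i]|/mapP[i]].
- by case: b => //; rewrite inE => /eqP; constructor 1.
- by constructor 2; exists i.
- by constructor 3; exists i.
- by constructor 4; exists i.
Qed.

Lemma mem_pivot_diag i : i \in pivot_diag -> (0 < i < N)%N && (b || (2 * i == N)%N).
Proof. by rewrite mem_filter => /andP[]. Qed.

Lemma mem_pairs i : i \in pairs -> (2 * i < N)%N.
Proof. by rewrite mem_filter => /andP[]. Qed.

Lemma matC_anti_x i : (2 * i < N)%N -> exists r r' : S,
  [/\ c i (rv i) = (x i i - x (rv i) (rv i)) * y i (rv i)
                  - (y i i - y (rv i) (rv i)) * x i (rv i) + r,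
      c (rv i) i = - (x i i - x (rv i) (rv i)) * y (rv i) i
                  + (y i i - y (rv i) (rv i)) * x (rv i) i + r',
      free_of (vx i i) r /\ free_of (vx i i) r' &
      free_of (vy i i) r /\ free_of (vy i i) r'].
Proof.
move=> iN; have ri : rv i != i by rewrite -val_eqE /= subSS; lia.
have ir : i != rv i by rewrite eq_sym.
exists (\sum_(l | (l != i) && (l != rv i)) (x i l * y l (rv i) - y i l * x l (rv i))).
exists (\sum_(l | (l != i) && (l != rv i)) (x (rv i) l * y l i - y (rv i) l * x l i)).
split; try (split; apply: free_sum => l /andP[li lr]; prove_free;
  by rewrite ?(negPf li) ?(negPf ri) ?(negPf ir) ?andbF).
- by rewrite matCE (bigD1 i) // (bigD1 (rv i)) //=; ring.
- by rewrite matCE (bigD1 i) // (bigD1 (rv i)) //=; ring.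
Qed.

(** Cramer's rule: in each combination the other diagonal variable cancels, and the remaining one
    gets the minor as coefficient. *)
Lemma free_pivot_elim i : (2 * i < N)%N ->
  [/\ free_of (vx i i) (elim_x i - minor i * x i i), free_of (vy i i) (elim_x i),
      free_of (vy i i) (elim_y i - minor i * y i i) & free_of (vx i i) (elim_y i)].
Proof.
move=> iN; have ri : rv i != i by rewrite -val_eqE /= subSS; lia.
have ir : i != rv i by rewrite eq_sym.
have [r [r' [E E' [xr xr'] [yr yr']]]] := matC_anti_x iN.
have -> : elim_x i = minor i * x i i - minor i * x (rv i) (rv i)
    + x (rv i) i * r + x i (rv i) * r' by rewrite /elim_x E E' /minor; ring.
have -> : elim_y i = minor i * y i i - minor i * y (rv i) (rv i)
    + y (rv i) i * r + y i (rv i) * r' by rewrite /elim_y E E' /minor; ring.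
split; rewrite /minor.
- rewrite [X in free_of _ X](_ : _ = - ((x (rv i) i * y i (rv i) - x i (rv i) * y (rv i) i)
    * x (rv i) (rv i)) + x (rv i) i * r + x i (rv i) * r'); last by ring.
  by prove_free => //; rewrite ?(negPf ri) ?(negPf ir) ?andbF.
- by prove_free => //; rewrite ?(negPf ri) ?(negPf ir) ?andbF.
- rewrite [X in free_of _ X](_ : _ = - ((x (rv i) i * y i (rv i) - x i (rv i) * y (rv i) i)
    * y (rv i) (rv i)) + y (rv i) i * r + y i (rv i) * r'); last by ring.
  by prove_free => //; rewrite ?(negPf ri) ?(negPf ir) ?andbF.
- by prove_free => //; rewrite ?(negPf ri) ?(negPf ir) ?andbF.
Qed.

(** Splits a condition on pairs from the list into the four families of pivots; it serves both
    distinctness of the variables and triangularity. *)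
Lemma pairwise_pivots (r : rel (S * S * 'I_(n * n + n * n))) :
  let t0 := (c ord0 ord0, - x oM ord0, @vy n ord0 oM) in
  let t1 i := (c i i, y oN i, vx i oN) in
  let t2 i := (elim_x i, minor i, vx i i) in
  let t3 i := (elim_y i, minor i, vy i i) in
  [/\ forall i, (0 < i < N)%N -> r t0 (t1 i),
      forall i, (2 * i < N)%N -> r t0 (t2 i) & forall i, (2 * i < N)%N -> r t0 (t3 i)] ->
  [/\ forall i j, (0 < i < N)%N -> (0 < j < N)%N -> i != j -> r (t1 i) (t1 j),
      forall i j, (0 < i < N)%N -> (2 * j < N)%N -> r (t1 i) (t2 j) &
      forall i j, (0 < i < N)%N -> (2 * j < N)%N -> r (t1 i) (t3 j)] ->
  [/\ forall i j, (2 * i < N)%N -> (2 * j < N)%N -> i != j -> r (t2 i) (t2 j),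
      forall i j, (2 * i < N)%N -> (2 * j < N)%N -> r (t2 i) (t3 j) &
      forall i j, (2 * i < N)%N -> (2 * j < N)%N -> i != j -> r (t3 i) (t3 j)] ->
  pairwise r pivots.
Proof.
move=> t0 t1 t2 t3 [r01 r02 r03] [r11 r12 r13] [r22 r23 r33].
have pd i : i \in pivot_diag -> (0 < i < N)%N by case/mem_pivot_diag/andP.
have pp i : i \in pairs -> (2 * i < N)%N by apply: mem_pairs.
have updiag : uniq pivot_diag by rewrite filter_uniq ?enum_uniq.
have upairs : uniq pairs by rewrite filter_uniq ?enum_uniq.
rewrite /pivots !pairwise_cat !allrel_catr; apply/and3P; split.
- have mem0 t : t \in (if b then [:: t0] else [::]) -> t = t0.
    by case: ifP; rewrite // inE => _ /eqP.
  apply/and3P; split; apply/allrelP => t t' /mem0-> /mapP[i ];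
    [move=> /pd h ->; exact: r01|move=> /pp h ->; exact: r02|move=> /pp h ->; exact: r03].
- by case: ifP.
apply/and3P; split.
- by apply/andP; split; apply/allrelP => t t' /mapP[i /pd hi ->] /mapP[j /pp hj ->];
    [apply: r12|apply: r13].
- by apply: pairwise_map_uniq => // i j /pd hi /pd hj; apply: r11.
apply/and3P; split.
- by apply/allrelP => t t' /mapP[i /pp hi ->] /mapP[j /pp hj ->]; apply: r23.
- by apply: pairwise_map_uniq => // i j /pp hi /pp hj; apply: r22.
- by apply: pairwise_map_uniq => // i j /pp hi /pp hj; apply: r33.
Qed.

Lemma uniq_pivots : uniq [seq t.2 | t <- pivots].
Proof.
rewrite uniq_pairwise pairwise_map.
apply: pairwise_pivots; split => i.
- by rewrite /= !vE.
- by rewrite /= !vE.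
- by move=> hi; rewrite /= !vE -!val_eqE /= ?val_oM; lia.
- by move=> j _ _ ij; rewrite /= !vE eqxx andbT.
- by move=> j hi hj; rewrite /= !vE -!val_eqE /=; lia.
- by move=> j _ _; rewrite /= !vE.
- by move=> j _ _ ij; rewrite /= !vE andbb.
- by move=> j _ _; rewrite /= !vE.
- by move=> j _ _ ij; rewrite /= !vE andbb.
Qed.

(** The diagonal entries come first because no x_jj or y_jj occurs in them. For 2 i, 2 j < N, the
    variables x_jj and y_jj occur in c_ii' and c_i'i only if i = j. *)
Lemma pairwise_free_pivots : pairwise (fun t t' => free_of t'.2 t.1.1) pivots.
Proof.
apply: pairwise_pivots; split=> i; [| | |move=> j|move=> j|move=> j|move=> j|move=> j|move=> j];
  rewrite /= => hi; [| | |move=> hj ij|move=> hj|move=> hj|move=> hj ij|move=> hj|move=> hj ij].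
- by apply: free_matC_x; rewrite -val_eqE /=; lia.
- exact: free_matC_diag_x.
- exact: free_matC_diag_y.
- by apply: free_matC_x; [rewrite eq_sym|rewrite -val_eqE /=; lia].
- exact: free_matC_diag_x.
- exact: free_matC_diag_y.
- rewrite /elim_x; prove_free; try (apply: free_matC_x);
    rewrite ?negb_and -?val_eqE /= ?subSS; move: ij; rewrite -?val_eqE /=; lia.
- have [<-|ij] := eqVneq i j; first by case: (free_pivot_elim hi).
  rewrite /elim_x; prove_free; try (apply: free_matC_y);
    rewrite ?negb_and -?val_eqE /= ?subSS; move: ij; rewrite -?val_eqE /=; lia.
- rewrite /elim_y; prove_free; try (apply: free_matC_y);
    rewrite ?negb_and -?val_eqE /= ?subSS; move: ij; rewrite -?val_eqE /=; lia.
Qed.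

Lemma free_pivot_rest t : t \in pivots -> free_of t.2 (t.1.1 - t.1.2 * 'X_t.2).
Proof.
move=> /mem_pivots[[_ ->]|[i /mem_pivot_diag hi ->]|[i /mem_pairs hi ->]|[i /mem_pairs hi ->]] /=.
- have oM0 : oM != ord0 by rewrite -val_eqE /= val_oM; lia.
  have [r -> [_ yr]] := matC_diag_rest k oM0.
  rewrite [X in free_of _ X](_ : _ = x ord0 oM * y oM ord0 + r); last by ring.
  by prove_free; rewrite // negb_and oM0.
- have oNi : oN != i by rewrite -val_eqE /=; lia.
  have [r -> [xr _]] := matC_diag_rest k oNi.
  rewrite [X in free_of _ X](_ : _ = - (y i oN * x oN i) + r); last by ring.
  by prove_free; rewrite // negb_and oNi.
- by case: (free_pivot_elim hi).
- by case: (free_pivot_elim hi).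
Qed.

Lemma free_pivot_coef t t' : t \in pivots -> t' \in pivots -> free_of t'.2 t.1.2.
Proof.
move=> /mem_pivots[[_ ->]|[i /mem_pivot_diag hi ->]|[i /mem_pairs hi ->]|[i /mem_pairs hi ->]];
move=> /mem_pivots[[_ ->]|[j /mem_pivot_diag hj ->]|[j /mem_pairs hj ->]|[j /mem_pairs hj ->]] /=;
  rewrite /minor; prove_free; rewrite ?negb_and -?val_eqE /= ?subSS ?val_oM; lia.
Qed.

Lemma big_pivots (R : Type) (idx : R) (op : Monoid.law idx)
    (F : S * S * 'I_(n * n + n * n) -> R) :
  \big[op/idx]_(t <- pivots) F t =
  op (\big[op/idx]_(t <- if b then [:: (c ord0 ord0, - x oM ord0, @vy n ord0 oM)] else [::]) F t)
  (op (\big[op/idx]_(i <- pivot_diag) F (c i i, y oN i, vx i oN))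
  (op (\big[op/idx]_(i <- pairs) F (elim_x i, minor i, vx i i))
   (\big[op/idx]_(i <- pairs) F (elim_y i, minor i, vy i i)))).
Proof. by rewrite /pivots !big_cat !big_map. Qed.

(** * Multipliers into the Frobenius power, and the case n >= 3 *)

Variable A : S -> Prop.
Hypothesis A_anti : forall i, A (c i (rv i)).
Hypothesis A_diag : b -> forall i, A (c i i).
Hypothesis A_inv : forall f, A f ->
  (exists i, f = c i (rv i)) \/ b /\ (exists i, f = c i i).
Local Notation I := (ideal_gen A).
Local Notation fp q := (frobenius_power I q).

Let fp_ideal q : ideal (fp q).
Proof. exact: ideal_gen_ideal. Qed.

Lemma pivot_ideal t : t \in pivots -> I t.1.1.
Proof.
have [_ ID IM] := ideal_gen_ideal A.
have Ianti i : I (c i (rv i)) by apply/mem_ideal_gen/A_anti.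
have Ianti' i : I (c (rv i) i) by have := Ianti (rv i); rewrite rev_ordK.
move=> /mem_pivots[[bT ->]|[i /mem_pivot_diag/andP[_ hi] ->]|[i _ ->]|[i _ ->]] /=.
- exact/mem_ideal_gen/A_diag.
- case/orP: hi => [bT|/eqP iN]; first exact/mem_ideal_gen/A_diag.
  by have := Ianti i; rewrite (_ : rv i = i) //; apply: val_inj; rewrite /= subSS; lia.
- by apply: ID; apply: IM.
- by apply: ID; apply: IM.
Qed.

Lemma fp_factor q r f P : (0 < q)%N -> I f -> P = r * f ^+ q.-1 -> fp q (P * f).
Proof.
move=> q0 If ->; rewrite -mulrA -exprSr prednK //.
exact: frobenius_power_exp.
Qed.

Lemma matC_diagN i : c i i = - \sum_(j | j != i) c j j.
Proof.
have := matC_trace k n; rewrite (bigD1 i) //= => /eqP.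
by rewrite addr_eq0 => /eqP.
Qed.

(** A diagonal pivot is itself a factor to the power q - 1, and a pair c_ii', c_i'i is handled by
    [pair_frobenius]. *)
Lemma pivots_mult q f : (0 < q)%N -> A f ->
  fp q (1 * \prod_(t <- pivots) t.1.1 ^+ q.-1 * f).
Proof.
move=> q0 Af; rewrite mul1r; set P := \prod_(t <- pivots) _.
have Ianti i : I (c i (rv i)) by apply/mem_ideal_gen/A_anti.
have Ianti' i : I (c (rv i) i) by have := Ianti (rv i); rewrite rev_ordK.
have PE := big_pivots *%R (fun t => t.1.1 ^+ q.-1).
have diag i : (i < N)%N -> b || (2 * i == N)%N -> fp q (P * c i i).
  move=> iN bi; have [i0|i0] := eqVneq i ord0.
    have bT : b by move: bi; rewrite i0 /=; case: (b) => //=; lia.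
    rewrite i0; apply: fp_factor => //; first exact/mem_ideal_gen/A_diag.
    rewrite /P PE (_ : (if b then _ else _) = [:: (c ord0 ord0, - x oM ord0, @vy n ord0 oM)]).
      by rewrite big_seq1 mulrC.
    by rewrite bT.
  have ipd : i \in pivot_diag.
    by move: i0; rewrite mem_filter mem_enum bi iN -val_eqE /= -lt0n => ->.
  apply: fp_factor => //.
    by apply: (@pivot_ideal (c i i, y oN i, vx i oN)); rewrite /pivots !mem_cat map_f ?orbT.
  by rewrite /P PE (big_rem i ipd) /= -mulrA mulrCA mulrC.
have pair i : (2 * i < N)%N -> fp q (P * c i (rv i)) /\ fp q (P * c (rv i) i).
  move=> iN; have ip : i \in pairs by rewrite mem_filter mem_enum iN.
  have [r Pr] : exists r, P = r * (elim_x i ^+ q.-1 * elim_y i ^+ q.-1).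
    rewrite /P PE (big_rem i ip) /= [X in _ * (_ * (_ * X))](big_rem i ip) /=.
    have reorg (a d g r2 h r3 : S) :
      a * (d * (g * r2 * (h * r3))) = (a * d * r2 * r3) * (g * h) by ring.
    by eexists; apply: reorg.
  have [_ _ fpM] := fp_ideal q.
  have fpf i' : fp q (c i' (rv i') ^+ q).
    by rewrite -[_ ^+ q]mul1r; apply: frobenius_power_exp.
  have fpf' i' : fp q (c (rv i') i' ^+ q).
    by rewrite -[_ ^+ q]mul1r; apply: frobenius_power_exp.
  rewrite Pr -!mulrA; split; apply: fpM; rewrite mulrA /elim_x /elim_y.
    exact: pair_frobenius.
  rewrite (addrC (x _ _ * _)) (addrC (y _ _ * _)).
  exact: pair_frobenius.
case: (A_inv Af) => [[i ->]|[bT [i ->]]].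
  have [iN|Ni|iN] := ltngtP (2 * i) N.
  - by case: (pair i iN).
  - have iN := ltn_ord i; case: (@pair (rv i)); first by rewrite /= subSS; lia.
    by rewrite rev_ordK.
  - have ri : rv i = i by apply: val_inj; rewrite /= subSS; lia.
    by rewrite ri; apply: diag; [lia|rewrite iN eqxx orbT].
(* The entry c_NN is no pivot for [b] true; as the trace is 0, it is minus the sum of the others. *)
have [->|iN] := eqVneq i oN; last first.
  apply: diag; last by rewrite bT.
  by move: iN (ltn_ord i); rewrite -val_eqE /=; lia.
rewrite matC_diagN mulrN; apply: (idealN (fp_ideal q)); rewrite mulr_sumr.
have [fp0 fpD _] := fp_ideal q; elim/big_ind: _ => // j jN.
apply: diag; last by rewrite bT.
by move: jN (ltn_ord j); rewrite -val_eqE /=; lia.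
Qed.

Definition entry_prod q : S := \prod_(t : 'I_n * 'I_n | entry_set t) c t.1 t.2 ^+ q.-1.

Lemma entry_prod_mult q f : (0 < q)%N -> A f -> fp q (entry_prod q * f).
Proof.
move=> q0 Af.
have entry t : entry_set t -> I (c t.1 t.2) -> fp q (entry_prod q * c t.1 t.2).
  move=> bt It; apply: fp_factor => //.
  by rewrite /entry_prod (bigD1 t) //= mulrC.
have diag i : b -> i != ord0 -> fp q (entry_prod q * c i i).
  move=> bT i0; apply: (@entry (i, i)); first by rewrite /entry_set /= bT eqxx i0 orbT.
  exact/mem_ideal_gen/A_diag.
case: (A_inv Af) => [[i ->]|[bT [i ->]]].
  by apply: (@entry (i, rv i)); [rewrite /entry_set /= eqxx|apply/mem_ideal_gen/A_anti].
(* Here the missing diagonal entry is c_00, again obtained from the trace. *)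
have [->|i0] := eqVneq i ord0; last exact: diag.
rewrite matC_diagN mulrN; apply: (idealN (fp_ideal q)); rewrite mulr_sumr.
by have [fp0 fpD _] := fp_ideal q; elim/big_ind: _ => // j jN; apply: diag.
Qed.

(** The leading monomial of D. Each minor counts twice, for x_ii and for y_ii. *)
Definition pivot_mnm : 'X_{1..n * n + n * n} :=
  ((if b then U_(@vx n oM ord0) else 0) +
   (\sum_(i <- pivot_diag) U_(@vy n oN i) +
   (\sum_(i <- pairs) (U_(@vx n (rv i) i) + U_(@vy n i (rv i))) +
    \sum_(i <- pairs) (U_(@vx n (rv i) i) + U_(@vy n i (rv i))))))%MM.

Lemma topmon_minor i : i \in pairs ->
  topmon wt (minor i) (U_(@vx n (rv i) i) + U_(@vy n i (rv i))).
Proof.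
move=> /mem_pairs iN; apply: topmonDr; first by apply: topmonM; apply: topmonXU.
apply/lowerN/lowerXX; rewrite wdegD !wdegU !wtE !val_rev.
move: (nat_of_ord i) iN => {}i iN.
by rewrite /weight_x /weight_y; split_ifs.
Qed.

Lemma topmon_pivots : topmon wt (\prod_(t <- pivots) t.1.2) pivot_mnm.
Proof.
have sub_prod (T : eqType) (s : seq T) (F : T -> S) (M : T -> 'X_{1..n * n + n * n}) :
    (forall t, t \in s -> topmon wt (F t) (M t)) ->
    topmon wt (\prod_(t <- s) F t) (\sum_(t <- s) M t)%MM.
  by move=> h; rewrite big_seq [X in topmon _ _ X]big_seq; apply: topmon_prod.
rewrite big_pivots /pivot_mnm; apply: topmonM.
  case: (b); last by rewrite big_nil; apply: topmon1.
  by rewrite big_seq1; apply/topmonN/topmonXU.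
apply: topmonM; first by apply: sub_prod => i _; apply: topmonXU.
by apply: topmonM; apply: sub_prod => i ip; apply: topmon_minor.
Qed.

(** One from each of the first two summands, and one from each of the two variables in each of the
    two copies of the minors. *)
Lemma pivot_mnm_le z : (pivot_mnm z <= 6)%N.
Proof.
have udiag : uniq pivot_diag by rewrite filter_uniq ?enum_uniq.
have upairs : uniq pairs by rewrite filter_uniq ?enum_uniq.
have le1 (s : seq 'I_n) (f : 'I_n -> 'I_(n * n + n * n)) : uniq s -> injective f ->
    ((\sum_(i <- s) U_(f i))%MM z <= 1)%N.
  move=> us fi; rewrite mnm_sumE; under eq_bigr do rewrite mnm1E.
  exact: sum_eq_le1.
rewrite /pivot_mnm !mnmDE !big_split /= !mnmDE.
have h0 : ((if b then U_(@vx n oM ord0) else 0)%MM z <= 1)%N.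
  by case: (b); rewrite ?mnm1E ?mnm0E // leq_b1.
have h1 : ((\sum_(i <- pivot_diag) U_(@vy n oN i))%MM z <= 1)%N.
  by apply: le1 => // i j /eqP; rewrite vy_eq eqxx => /eqP.
have h2 : ((\sum_(i <- pairs) U_(@vx n (rv i) i))%MM z <= 1)%N.
  by apply: le1 => // i j /eqP; rewrite vx_eq => /andP[_ /eqP].
have h3 : ((\sum_(i <- pairs) U_(@vy n i (rv i)))%MM z <= 1)%N.
  by apply: le1 => // i j /eqP; rewrite vy_eq => /andP[/eqP].
lia.
Qed.

(** So D has a leading monomial coprime to those of the entries. *)
Lemma pivot_mnm_eq0 z : owner z != (N.+1, N.+1) -> pivot_mnm z = 0%N.
Proof.
move=> zN; have out v : owner v = (N.+1, N.+1) -> (v == z) = false.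
  by move=> vN; apply: contraNF zN => /eqP <-; rewrite vN.
rewrite /pivot_mnm !mnmDE !mnm_sumE.
have -> : ((if b then U_(@vx n oM ord0) else 0)%MM z = 0)%N.
  case: (b); rewrite ?mnm0E // mnm1E out // ownerE val_oM /=.
  by rewrite /owner_x; split_ifs.
have h2 i : i \in pairs -> (U_(@vx n (rv i) i) + U_(@vy n i (rv i)))%MM z = 0%N.
  move=> /mem_pairs iN; rewrite mnmDE !mnm1E !out // ownerE !val_rev.
    by rewrite /owner_y; split_ifs.
  by rewrite /owner_x; split_ifs.
rewrite [X in (_ + (X + _))%N]big_seq big1 => [|i /mem_pivot_diag/andP[iN _]].
  by rewrite add0n !add0n [X in (X + _)%N]big_seq [X in (_ + X)%N]big_seq !big1.
by rewrite mnm1E out // ownerE /=; rewrite /owner_y; split_ifs.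
Qed.

Variables (p : nat) (charkp : p \in [pchar k]) (J : idealr S).
Hypothesis JE : forall f, f \in (J : {pred _}) <-> ideal_gen A f.

Lemma large_F_regular v : F_regular v {ideal_quot J}.
Proof.
have p_gt1 := prime_gt1 (pcharf_prime charkp).
(* An exponent of [mu] is at most q - 1 for a variable with an owner and at most 6 for any other, so
   q >= 8 is enough. *)
set q := (p ^ 3)%N; have q8 : (8 <= q)%N by rewrite (@leq_exp2r 2 p 3).
have q0 e : (0 < p ^ e)%N by rewrite expn_gt0 (ltnW p_gt1).
pose mu := (\sum_(t : 'I_n * 'I_n | entry_set t) lead_mnm t *+ q.-1 + (0 + pivot_mnm))%MM.
apply: (@ideal_gen_quot_F_regular k _ p charkp A J pivots 1 wt 3 (entry_prod q) mu JE).
- exact: uniq_pivots.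
- exact: pairwise_free_pivots.
- exact: free_pivot_rest.
- exact: free_pivot_coef.
- exact: pivot_ideal.
- by move=> t _; apply: free1.
- by move=> e f; apply: pivots_mult.
- by move=> f; apply: entry_prod_mult.
- move=> z; rewrite /mu (mnmDE z _ (0 + pivot_mnm)) (mnmDE z 0 pivot_mnm) mnm0E add0n.
  rewrite [X in (X + _)%N]mnm_sumE -/q.
  under eq_bigr do rewrite mulmnE.
  rewrite -big_distrl /=.
  have [zN|zN] := eqVneq (owner z) (N.+1, N.+1).
    by rewrite (sum_lead_mnm_eq0 zN) mul0n add0n (leq_ltn_trans (pivot_mnm_le z)) //; lia.
  rewrite (pivot_mnm_eq0 zN) addn0; have := sum_lead_mnm_le1 z.
  by case: (\sum_(t | _) _) => [|[|//]]; rewrite ?mul0n ?mul1n; lia.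
apply: topmonM.
  by apply: topmon_prod => t bt; exact: topmonXn (topmon_entry bt).
by apply: topmonM; [exact: topmon1|exact: topmon_pivots].
Qed.

End LargeMatrices.

(** * The anti-diagonal entries for n = 2 *)

(** As [T] is a domain, the kernel of the map induced on the quotient is a prime inside [P], so by
    minimality it equals [P]. *)
Lemma minimal_prime_quot_kernel (S : comNzRingType) (J : idealr S)
    (T : idomainType) (phi : {rmorphism S -> T})
    (P : {ideal_quot J} -> Prop) f :
  (forall g, g \in (J : {pred S}) -> phi g = 0) -> minimal_prime P ->
  (forall g, phi g = 0 -> P (\pi_({ideal_quot J}) g)%qT) ->
  P (\pi_({ideal_quot J}) f)%qT -> phi f = 0.
Proof.
move=> phiJ [primeP minP] kerP Pf.
pose Q (r : {ideal_quot J}) := phi (repr r) = 0.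
have phi_repr g : phi (repr (\pi_({ideal_quot J}) g)%qT) = phi g.
  apply/esym/eqP; rewrite -subr_eq0 -rmorphB; apply/eqP/phiJ.
  exact: ideal_quot_repr.
have piE (x : {ideal_quot J}) : x = (\pi_({ideal_quot J}) (repr x))%qT by rewrite reprK.
have piD (x y : S) : (\pi_({ideal_quot J}) (x + y) =
  \pi_({ideal_quot J}) x + \pi_({ideal_quot J}) y)%qT := rmorphD _ x y.
have piM (x y : S) : (\pi_({ideal_quot J}) (x * y) =
  \pi_({ideal_quot J}) x * \pi_({ideal_quot J}) y)%qT := rmorphM _ x y.
rewrite -phi_repr; apply: (minP Q) => //; last first.
  by move=> x Qx; rewrite (piE x); apply: kerP.
split; last 1 first.
- move=> x y; rewrite /Q (piE x) (piE y) -piM !phi_repr rmorphM => /eqP.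
  by rewrite mulf_eq0 => /orP[]/eqP; [left|right].
- split; rewrite /Q.
  + by rewrite -[0](rmorph0 (\pi_({ideal_quot J}))%qT) phi_repr rmorph0.
  + by move=> x y; rewrite (piE x) (piE y) -piD !phi_repr rmorphD => -> ->; rewrite addr0.
  + by move=> a x; rewrite (piE a) (piE x) -piM !phi_repr rmorphM => ->; rewrite mulr0.
- rewrite /Q -[1](rmorph1 (\pi_({ideal_quot J}))%qT) phi_repr rmorph1.
  by apply/eqP; rewrite oner_eq0.
Qed.

(** A substitution that is trivial modulo [K] on variables is trivial modulo [K]; below, this places
    its kernel inside [K]. *)
Lemma mpoly_sub_endo (k : fieldType) (N : nat) (K : {mpoly k[N]} -> Prop)
    (phi : {rmorphism {mpoly k[N]} -> {mpoly k[N]}}) :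
  ideal K -> (forall a, phi a%:MP = a%:MP) ->
  (forall i, K ('X_i - phi 'X_i)) -> forall f, K (f - phi f).
Proof.
move=> idK phiC phiX; have [K0 KD KM] := idK.
have HM f g : K (f - phi f) -> K (g - phi g) -> K (f * g - phi (f * g)).
  move=> Kf Kg; have -> : f * g - phi (f * g) = g * (f - phi f) + phi f * (g - phi g).
    by rewrite rmorphM; ring.
  by apply: KD; apply: KM.
apply: mpoly_ind_mon => [|f g Kf Kg|a m].
- by rewrite rmorph0 subr0.
- by rewrite rmorphD opprD addrACA; apply: KD.
rewrite -mul_mpolyC; apply: (HM); first by rewrite phiC subrr.
rewrite mpolyXE_id; elim/big_ind: _ => [|//|i _]; first by rewrite rmorph1 subrr.
by elim: (m i) => [|j IH]; [rewrite expr0 rmorph1 subrr|rewrite exprS; apply: HM].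
Qed.

Lemma mpoly_subst (k : fieldType) (N : nat) (T : comNzRingType)
    (f : {rmorphism k -> T}) (h : 'I_N -> T) :
  exists phi : {rmorphism {mpoly k[N]} -> T},
    (forall a, phi a%:MP = f a) /\ (forall i, phi 'X_i = h i).
Proof.
by exists (mmap f h); split=> [a|i]; rewrite /= ?mmapC // mmapX mmap1U.
Qed.

Lemma rmorph_horner0 (k : fieldType) (N : nat)
    (phi : {rmorphism {mpoly k[N]} -> {poly k}}) :
  (forall a, phi a%:MP = a%:P) -> (forall i, (phi 'X_i).[0] = 0) ->
  forall f, (phi f).[0] = f@_0%MM.
Proof.
move=> phiC phi0; apply: mpoly_ind_mon => [|f g IHf IHg|a m].
- by rewrite rmorph0 horner0 mcoeff0.
- by rewrite rmorphD hornerD IHf IHg mcoeffD.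
rewrite -mul_mpolyC rmorphM phiC hornerM hornerC mcoeffCM mcoeffX; congr (_ * _).
rewrite mpolyXE_id rmorph_prod horner_prod; have [->|m0] := eqVneq m 0%MM.
  by rewrite big1 // => i _; rewrite mnm0E expr0 rmorph1 hornerC.
have [i mi] : exists i, m i != 0%N.
  apply/existsP; rewrite -negb_forall; apply: contra m0 => /forallP m0.
  by apply/eqP/mnmP => i; rewrite mnm0E; apply/eqP.
by rewrite (bigD1 i) //= rmorphXn horner_exp phi0 expr0n (negPf mi) mul0r.
Qed.

Lemma commutator_var_ind n (P : 'I_(n * n + n * n) -> Prop) :
  (forall i j, P (vx i j)) -> (forall i j, P (vy i j)) -> forall z, P z.
Proof.
move=> Px Py z; rewrite -(splitK z).
by case: (split z) => z'; case/mxvec_indexP: z'.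
Qed.

Section TwoByTwoAntiDiagonal.
Variable k : fieldType.
Local Notation S := {mpoly k[2 * 2 + 2 * 2]}.
Local Notation o := (ord0 : 'I_2).
Local Notation u := (ord_max : 'I_2).
Local Notation x i j := ('X_(@vx 2 i j) : S).
Local Notation y i j := ('X_(@vy 2 i j) : S).
Local Notation c := (matC k 2).
Local Notation I := (ideal_gen (@antidiag_entry k 2)).
Local Notation R := {ideal_quot (ideal_a k 2)}.

Let a : S := x o o - x u u.
Let b : S := y o o - y u u.
Let d : S := x u o * y o u - x o u * y u o.

Let c_ou : c o u = a * y o u - b * x o u.
Proof. by rewrite matC_2 /a /b; ring. Qed.

Let c_uo : c u o = x u o * b - a * y u o.
Proof. by rewrite matC_2 /a /b; ring. Qed.

Lemma antidiag_2_inv (T : comNzRingType) (phi : {rmorphism S -> T}) :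
  phi (c o u) = 0 -> phi (c u o) = 0 -> forall f, I f -> phi f = 0.
Proof.
move=> ou uo f; apply: (ideal_gen_min (I := fun f => phi f = 0)).
  by split=> [|g h pg ph|g h ph]; rewrite ?rmorph0 // ?rmorphD ?rmorphM ?pg ph ?addr0 ?mulr0.
move=> g [i ->]; have [->|->] : i = o \/ i = u.
- by case: i => [[|[|//]] ?]; [left|right]; apply: val_inj.
- by rewrite (_ : rev_ord o = u) //; apply: val_inj.
- by rewrite (_ : rev_ord u = o) //; apply: val_inj.
Qed.

Let I_ou : I (c o u).
Proof. by apply: mem_ideal_gen; exists o; congr (c _ _); apply: val_inj. Qed.

Let I_uo : I (c u o).
Proof. by apply: mem_ideal_gen; exists u; congr (c _ _); apply: val_inj. Qed.

Lemma antidiag_2_ad : I (a * d).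
Proof.
have [_ ID IM] := ideal_gen_ideal (@antidiag_entry k 2).
have -> : a * d = x u o * c o u + x o u * c u o by rewrite c_ou c_uo /d; ring.
by apply: ID; apply: IM.
Qed.

(** Two substitutions killing the ideal contradict each other: the first has a = X, d = 0 and forces
    the constant term of r to be 1, the second has a = 0, d = X^2 and forces it to be 0. *)
Lemma antidiag_2_notin r : ~ I (a - r * (a + d)).
Proof.
move=> Ir.
pose h1 := @matfun 2 {poly k} (fun i j => if (i == o) && (j == o) then 'X else 0) (fun _ _ => 0).
pose h2 := @matfun 2 {poly k} (fun i j => if (i == u) && (j == o) then 'X else 0)
  (fun i j => if (i == o) && (j == u) then 'X else 0).
have [phi1 [phi1C phi1X]] := mpoly_subst (polyC : {rmorphism k -> {poly k}}) h1.
have [phi2 [phi2C phi2X]] := mpoly_subst (polyC : {rmorphism k -> {poly k}}) h2.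
have E1 : phi1 (a - r * (a + d)) = 0.
  by apply: antidiag_2_inv Ir; rewrite (c_ou, c_uo) rmorphB !rmorphM /a /b !rmorphB !phi1X
    /h1 !(matfun_vx, matfun_vy) /=; ring.
have E2 : phi2 (a - r * (a + d)) = 0.
  by apply: antidiag_2_inv Ir; rewrite (c_ou, c_uo) rmorphB !rmorphM /a /b !rmorphB !phi2X
    /h2 !(matfun_vx, matfun_vy) /=; ring.
have r1 : r@_0%MM = 1.
  rewrite -(rmorph_horner0 phi1C); last first.
    by apply: commutator_var_ind => i j; rewrite phi1X /h1 ?matfun_vx ?matfun_vy;
      [case: ifP|]; rewrite ?hornerX ?horner0.
  have a1 : phi1 a = 'X by rewrite rmorphB !phi1X /h1 !matfun_vx /= subr0.
  have d1 : phi1 d = 0.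
    by rewrite rmorphB !rmorphM !phi1X /h1 !matfun_vx !matfun_vy /= !mul0r subr0.
  move: E1; rewrite (rmorphB phi1 a) (rmorphM phi1 r) (rmorphD phi1 a) a1 d1 addr0 => /eqP.
  rewrite -{1}['X]mul1r -mulrBl mulf_eq0 polyX_eq0 orbF subr_eq0 => /eqP <-.
  by rewrite hornerC.
have r0 : r@_0%MM = 0.
  rewrite -(rmorph_horner0 phi2C); last first.
    by apply: commutator_var_ind => i j; rewrite phi2X /h2 ?matfun_vx ?matfun_vy;
      case: ifP; rewrite ?hornerX ?horner0.
  have a2 : phi2 a = 0 by rewrite rmorphB !phi2X /h2 !matfun_vx /= subr0.
  have d2 : phi2 d = 'X * 'X.
    by rewrite rmorphB !rmorphM !phi2X /h2 !matfun_vx !matfun_vy /= !mul0r subr0.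
  move: E2; rewrite (rmorphB phi2 a) (rmorphM phi2 r) (rmorphD phi2 a) a2 d2 !add0r => /eqP.
  rewrite oppr_eq0 !mulf_eq0 polyX_eq0 !orbF => /eqP ->.
  by rewrite horner0.
by move/eqP: r1; rewrite r0 eq_sym oner_eq0.
Qed.

(** A minimal prime containing a + d contains both a and d, because a d = 0. It is then compared
    with the kernel of a substitution that does not kill d, if b lies in it, or a, if not. *)
Lemma antidiag_2_off_minimal_primes :
  off_minimal_primes (\pi_R (a + d))%qT.
Proof.
move=> P minP Pad; have [[[P0 PD PM] _ Pprime] _] := minP.
have PN z : P z -> P (- z) by apply: idealN.
have piD (f g : S) : (\pi_R (f + g) = \pi_R f + \pi_R g)%qT := rmorphD _ f g.
have piM (f g : S) : (\pi_R (f * g) = \pi_R f * \pi_R g)%qT := rmorphM _ f g.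
have pi0 f : I f -> (\pi_R f = 0)%qT by move=> If; apply/ideal_quot_eq0/ideal_aE.
pose K f := P (\pi_R f)%qT.
have idK : ideal K.
  split; rewrite /K; first by rewrite (pi0 0) //; case: (ideal_gen_ideal (@antidiag_entry k 2)).
    by move=> f g; rewrite piD; apply: PD.
  by move=> f g; rewrite piM; apply: PM.
have [_ KD KM] := idK.
have KI f : I f -> K f by move=> If; rewrite /K pi0.
have Kprime f g : K (f * g) -> K f \/ K g by rewrite /K piM; apply: Pprime.
have [Ka Kd] : K a /\ K d.
  have [Ka|Kd] := Kprime _ _ (KI _ antidiag_2_ad).
    by split=> //; rewrite (_ : d = (a + d) - a); [apply: idealB|ring].
  by split=> //; rewrite (_ : a = (a + d) - d); [apply: idealB|ring].
have minimal (phi : {rmorphism S -> S}) f : phi (c o u) = 0 -> phi (c u o) = 0 ->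
    (forall g, phi g = 0 -> K g) -> K f -> phi f = 0.
  move=> ou uo kerK; apply: minimal_prime_quot_kernel => // g /ideal_aE.
  exact: antidiag_2_inv.
have d_neq0 : d <> 0.
  move/(congr1 (meval (fun z => ((z == vx u o) || (z == vy o u))%:R))) => /eqP.
  rewrite /d meval0 mevalB !mevalM !mevalXU !vE /= mul1r mul0r subr0.
  by rewrite oner_eq0.
have [Kb|nKb] := pselect (K b).
  (* Identifying x_11 with x_00 and y_11 with y_00 kills a and b, hence the ideal, but fixes d. *)
  pose h := @matfun 2 S (fun i j => if (i == u) && (j == u) then x o o else x i j)
                        (fun i j => if (i == u) && (j == u) then y o o else y i j).
  have [phi [phiC phiX]] := mpoly_subst (@mpolyC _ k : {rmorphism k -> S}) h.
  have hx i j : phi (x i j) = if (i == u) && (j == u) then x o o else x i j.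
    by rewrite phiX /h matfun_vx.
  have hy i j : phi (y i j) = if (i == u) && (j == u) then y o o else y i j.
    by rewrite phiX /h matfun_vy.
  have phia : phi a = 0 by rewrite rmorphB !hx subrr.
  have phib : phi b = 0 by rewrite rmorphB !hy subrr.
  apply: d_neq0; transitivity (phi d).
    by rewrite rmorphB !rmorphM !hx !hy.
  apply: minimal => //.
  - by rewrite c_ou rmorphB !rmorphM phia phib !mul0r subr0.
  - by rewrite c_uo rmorphB !rmorphM phia phib mulr0 mul0r subr0.
  move=> g g0; rewrite -[g]subr0 -g0; apply: mpoly_sub_endo => //.
  apply: commutator_var_ind => i j; rewrite ?hx ?hy; case: ifP => [/andP[/eqP-> /eqP->]|_];
    rewrite ?subrr; try by case: idK.
    by rewrite -opprB; apply: idealN.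
  by rewrite -opprB; apply: idealN.
(* Modulo a, the generators are b x_01 and b x_10 up to sign, and b is not in the prime. *)
have [Kou Kuo] : K (x o u) /\ K (x u o).
  split; [have := KI _ I_ou|have := KI _ I_uo]; rewrite (c_ou, c_uo) => Kc.
    case: (@Kprime b (x o u)) => //.
    rewrite (_ : b * x o u = y o u * a - (a * y o u - b * x o u)); last by ring.
    by apply: idealB => //; apply: KM.
  case: (@Kprime b (x u o)) => //.
  rewrite (_ : b * x u o = (x u o * b - a * y u o) + y u o * a); last by ring.
  by apply: KD => //; apply: KM.
(* This sends (a, x_01, x_10) to x_00 (b, y_01, y_10), with x_00 as a free parameter, so the
   generators vanish while a goes to x_00 b. *)
pose h := @matfun 2 S (fun i j => if (i == o) && (j == o) then x u u + x o o * b else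
    if (i == u) && (j == u) then x u u else x o o * y i j) (fun i j => y i j).
have [phi [phiC phiX]] := mpoly_subst (@mpolyC _ k : {rmorphism k -> S}) h.
have hx i j : phi (x i j) = if (i == o) && (j == o) then x u u + x o o * b else
    if (i == u) && (j == u) then x u u else x o o * y i j.
  by rewrite phiX /h matfun_vx.
have hy i j : phi (y i j) = y i j by rewrite phiX /h matfun_vy.
(* After x_00 is set to 0, the composite fixes every variable modulo a, x_01 and x_10, so the kernel
   of [phi] lies in [K]. *)
have [psi [psiC psiX]] := mpoly_subst (@mpolyC _ k : {rmorphism k -> S})
  (fun z => if z == vx o o then 0 else 'X_z).
have phia : phi a = x o o * b by rewrite rmorphB !hx /=; ring.
have phib : phi b = b by rewrite rmorphB !hy.
have : phi a = 0.
  apply: minimal => //.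
  - by rewrite c_ou rmorphB !rmorphM phia phib hx hy /=; ring.
  - by rewrite c_uo rmorphB !rmorphM phia phib hx hy /=; ring.
  move=> g g0; rewrite -[g]subr0 -(rmorph0 psi) -g0.
  apply: (mpoly_sub_endo (phi := psi \o phi)) => // [e|].
    by rewrite /= phiC psiC.
  apply: commutator_var_ind => i j /=; last first.
    by rewrite hy psiX vE subrr; case: idK.
  rewrite hx; case: ifP => [/andP[/eqP-> /eqP->]|oo].
    by rewrite rmorphD rmorphM !psiX !vE /= mul0r addr0.
  case: ifP => [/andP[/eqP-> /eqP->]|uu]; first by rewrite psiX vE /= subrr; case: idK.
  rewrite rmorphM !psiX !vE /= mul0r subr0.
  have [[-> ->]|[-> ->]] : (i = o /\ j = u) \/ (i = u /\ j = o); [|exact: Kou|exact: Kuo].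
  case: i oo uu => [[|[|//]] ?]; case: j => [[|[|//]] ?] //= _ _; [left|right];
    by split; apply: val_inj.
rewrite phia => /eqP; rewrite mulf_eq0 => /orP[]/eqP.
  move/(congr1 (meval (fun z => 1))) => /eqP.
  by rewrite meval0 mevalXU oner_eq0.
move/(congr1 (meval (fun z => (z == vy o o)%:R))) => /eqP.
by rewrite /b meval0 mevalB !mevalXU !vE /= subr0 oner_eq0.
Qed.

(** Both sides equal a^(q+1), as all products involving a d vanish. *)
Lemma antidiag_2_mul q : (0 < q)%N ->
  (\pi_R (a + d) * \pi_R a ^+ q = \pi_R a * \pi_R (a + d) ^+ q)%qT.
Proof.
have piD (f g : S) : (\pi_R (f + g) = \pi_R f + \pi_R g)%qT := rmorphD _ f g.
have piM (f g : S) : (\pi_R (f * g) = \pi_R f * \pi_R g)%qT := rmorphM _ f g.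
have ad0 : (\pi_R a * \pi_R d = 0)%qT.
  by rewrite -piM; apply/ideal_quot_eq0/ideal_aE/antidiag_2_ad.
case: q => // q _; rewrite piD mulrDl [_ ^+ q.+1]exprS mulrA.
move: (\pi_R a)%qT (\pi_R d)%qT ad0 => A D AD.
rewrite mulrA [D * A]mulrC AD mul0r addr0.
have E m : A * (A + D) ^+ m = A * A ^+ m.
  elim: m => [|m IH]; first by rewrite !expr0.
  by rewrite !exprS mulrCA IH mulrDl [D * (_ * _)]mulrA [D * A]mulrC AD mul0r addr0.
by rewrite E exprS mulrA.
Qed.

Lemma antidiag_2_not_mem r : (\pi_R a <> r * \pi_R (a + d))%qT.
Proof.
have piB (f g : S) : (\pi_R (f - g) = \pi_R f - \pi_R g)%qT := rmorphB _ f g.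
have piM (f g : S) : (\pi_R (f * g) = \pi_R f * \pi_R g)%qT := rmorphM _ f g.
rewrite -[r]reprK -piM => E; apply: (@antidiag_2_notin (repr r)).
by apply/ideal_aE/ideal_quot_eq0; rewrite piB E subrr.
Qed.

Lemma ideal_a_2_not_weakly_F_regular : ~ weakly_F_regular R.
Proof.
case=> p charRp wF; set C := (\pi_R (a + d))%qT.
pose I0 (z : R) := exists r, z = r * C.
have idI0 : ideal I0.
  split; first by exists 0; rewrite mul0r.
    by move=> z z' [r ->] [r' ->]; exists (r + r'); rewrite mulrDl.
  by move=> e z [r ->]; exists (e * r); rewrite mulrA.
case: (wF I0 idI0 (\pi_R a)%qT) => [|r]; last exact: antidiag_2_not_mem.
exists C; first exact: antidiag_2_off_minimal_primes.
exists 0%N => e _; rewrite antidiag_2_mul.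
  by apply: frobenius_power_exp; exists 1; rewrite mul1r.
by rewrite expn_gt0 (prime_gt0 (pcharf_prime charRp)).
Qed.

Lemma ideal_a_2_not_F_regular v : ~ F_regular v R.
Proof.
case: v => /=; last exact: ideal_a_2_not_weakly_F_regular.
  case=> p [charRp sF]; set C := (\pi_R (a + d))%qT.
  have [e e0 [phi phiE]] := sF C antidiag_2_off_minimal_primes.
  have q0 : (0 < p ^ e)%N by rewrite expn_gt0 (prime_gt0 (pcharf_prime charRp)).
  (* For c = a + d, linearity gives c phi(a^(1/q)) = phi((c^q a)^(1/q)) = phi((a^q c)^(1/q)) = a, so
     a would be a multiple of c. *)
  apply: (@antidiag_2_not_mem (phi (qroot e charRp (\pi_R a)%qT))).
  rewrite mulrC -[LHS]phiE -[RHS]/(C *: phi (qroot e charRp (\pi_R a)%qT)) -linearZ.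
  congr (phi _); rewrite -[LHS]/((\pi_R a) ^+ (p ^ e) * C)%qT.
  by rewrite mulrC antidiag_2_mul // mulrC.
move=> lF; apply: ideal_a_2_not_weakly_F_regular.
apply: (lF _ _ _ _ (is_localization_id R)).
by split=> // z z' -> ->; rewrite mulr1.
Qed.

End TwoByTwoAntiDiagonal.

Theorem theorem1p2 (v : F_regularity) (k : fieldType) (p : nat)
    (charkp : p \in [pchar k]) (n : nat) (n_ge1 : (1 <= n)%N) :
  F_regular v {ideal_quot (ideal_c k n)} /\
  (F_regular v {ideal_quot (ideal_a k n)} <-> n <> 2%N).
Proof.
case: n n_ge1 => [//|[|[|N]]] _.
- split; last split=> // _.
    apply: (quot_zero_ideal_F_regular charkp v (@ideal_cE k 1)).
    by move=> f [] [i ->]; rewrite matC_1.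
  apply: (quot_zero_ideal_F_regular charkp v (@ideal_aE k 1)).
  by move=> f [i ->]; rewrite matC_1.
- split; first exact: (ideal_c_2_F_regular charkp).
  by split=> // /ideal_a_2_not_F_regular.
split.
  apply: (large_F_regular (b := true) _ _ _ _ charkp (@ideal_cE k N.+3)) => //.
  - by move=> i; right; exists i.
  - by move=> _ i; left; exists i.
  - by move=> f [[i ->]|[i ->]]; [right; split=> //|left]; exists i.
split=> // _.
apply: (large_F_regular (b := false) _ _ _ _ charkp (@ideal_aE k N.+3)) => //.
- by move=> i; exists i.
- by move=> f [i ->]; left; exists i.
Qed.
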